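(* Let $m,n,d,e,k$ be positive integers with $m=2n$, $e=\gcd(n,d)=\gcd(m,d)$ and $1\le k\le\frac{n}{e}$, and let $B_{\vec a}$ be as in the context. For even $r$ with $0\le r\le m/e$, let \[\beta_r=2^{-m}\#\{\vec a\in\mathbb{F}_{2^n}\times\mathbb{F}_{2^m}^k\mid {\rm rk}(B_{\vec a})=r,\ (a_0,a_1,\dots,a_{k-1})\ne0\}.\] Then for each $j=0,1,\dots,k-1$, \[\beta_{\frac{m}{e}-2j}=\sum_{v=j}^{k-1}(-1)^{v-j}4^{e\binom{v-j}{2}}\binom{v}{j}_{4^e}\binom{\frac{m}{2e}}{v}_{4^e}\big(2^{n(2k-1-2v)+ev}-1\big).\]
   Context: For $\vec a=(a_0,\dots,a_k)\in\mathbb{F}_{2^n}\times\mathbb{F}_{2^m}^k$, $B_{\vec a}$ is the $\mathbb{F}_{2^e}$-bilinear form on $\mathbb{F}_{2^m}$ given by \[B_{\vec a}(x,y)={\rm Tr}_{\mathbb{F}_{2^n}/\mathbb{F}_{2^e}}\big(a_0(xy^{2^{nd/e}}+x^{2^{nd/e}}y)\big)+\sum_{j=1}^{k-1}{\rm Tr}_{\mathbb{F}_{2^m}/\mathbb{F}_{2^e}}\big(a_j(xy^{2^{(\frac{n}{e}-j)d}}+x^{2^{(\frac{n}{e}-j)d}}y)\big).\] Its rank ${\rm rk}(B_{\vec a})$ is $m/e$ minus the $\mathbb{F}_{2^e}$-dimension of $\{x\mid B_{\vec a}(x,y)=0\ \forall y\}$. $\binom{a}{b}_q$ is the Gaussian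 binomial coefficient and $\binom{a}{2}=a(a-1)/2$. *)

(* Defs.v *)
From HB Require Import structures.
From mathcomp Require Import all_boot all_order all_algebra all_field.
Unset Printing Implicit Defensive.
Import Order.TTheory GRing.Theory Num.Theory.
Local Open Scope ring_scope.


(* The subfield F_{2^t} of F (F has characteristic 2, #|F| = 2^m, t | m). *)
Definition subF (F : finFieldType) (t : nat) : {set F} := [set x : F | x ^+ (2 ^ t) == x].

Definition trace (F : finFieldType) (e s : nat) (x : F) : F := \sum_(i < s) x ^+ (2 ^ (e * i)).

Definition Bform (F : finFieldType) (n m d e k : nat) (a : {ffun 'I_k.+1 -> F}) (x y : F) : F :=
  trace F e (n %/ e)
    (a ord0 * (x * y ^+ (2 ^ (n * d %/ e)) + x ^+ (2 ^ (n * d %/ e)) * y))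
  + \sum_(1 <= j < k) trace F e (m %/ e)
    (a (inord j) * (x * y ^+ (2 ^ ((n %/ e - j) * d))
                    + x ^+ (2 ^ ((n %/ e - j) * d)) * y)).

Definition radical (F : finFieldType) (n m d e k : nat) (a : {ffun 'I_k.+1 -> F}) : {set F} :=
  [set x : F | [forall y : F, Bform F n m d e k a x y == 0]].

Definition lin_indep (F : finFieldType) (K : {set F}) (t : nat) (v : {ffun 'I_t -> F}) : bool :=
  [forall c : {ffun 'I_t -> F},
     [forall i, c i \in K] ==> (\sum_i c i * v i == 0) ==> [forall i, c i == 0]].

(* dimension over K of V: the maximal size of a K-linearly independent
   family of elements of V (any such family has size <= #|F|). *)
Definition dim_over (F : finFieldType) (K V : {set F}) : nat :=
  \max_(t < #|F|.+1 | [exists v : {ffun 'I_t -> F},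
                          [forall i, v i \in V] && @lin_indep F K t v]) t.

Definition rankB (F : finFieldType) (n m d e k : nat) (a : {ffun 'I_k.+1 -> F}) : nat :=
  (m %/ e - dim_over F (subF F e) (radical F n m d e k a))%N.

Definition beta (F : finFieldType) (n m d e k r : nat) : rat :=
  (#|[set a : {ffun 'I_k.+1 -> F} |
      [&& a ord0 \in subF F n, rankB F n m d e k a == r &
          [exists i : 'I_k.+1, (i < k)%N && (a i != 0)]]]|%:R)
  / (2 ^ m)%:R.


(* Gaussian binomial [a choose b]_q = prod_{i<b} (q^(a-i) - 1)/(q^(i+1) - 1);
   it is 0 when b > a (the factor i = a vanishes). *)
Definition gbinom (q a b : nat) : rat :=
  \prod_(i < b) (((q%:Q) ^+ (a - i) - 1) / ((q%:Q) ^+ i.+1 - 1)).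

(* Main.v *)
(* Put q = 2^e, N = n/e, M = m/e = 2N, and let sigma : x |-> x^(2^d), a generator
   of the Galois group over F_q because d/e is odd and prime to M.  Then
   B_a(x, y) = Tr(L_a(x) y) with L_a a sigma-polynomial supported on the 2k-1
   consecutive exponents N-k+1, ..., N+k-1.
   - A nonzero sigma-polynomial with 2k-1 consecutive terms has a kernel of
     dimension at most 2k-2, and an alternating form has even rank: the radicals
     of the nonzero forms have dimensions 2i with i < k.
   - For v < k and independent x_1, ..., x_v, a character sum counts the forms
     whose radical contains all x_i: the forms B_a are equidistributed as if
     they ranged over all alternating forms.  The dual count amounts to Cartan's
     lemma: if sum_i x_i /\ y_i = 0 then y = Sx with S symmetric.
   - This yields the first k moments of q^(dim rad) in the basis
     prod_(i<v) (X - q^i).  To pass to the basis prod_(i<v) (X - q^(2i)) one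
     compares with the expectation over all alternating matrices, computed by
     adding one row and column at a time.  These moments are those of the
     Gaussian binomials of base q^2, and q-inversion gives the formula. *)
Require Import Defs.
From HB Require Import structures.
From mathcomp Require Import all_boot all_order all_algebra all_field.
From mathcomp Require Import ring zify.
Import Order.TTheory GRing.Theory Num.Theory.
Local Open Scope ring_scope.

(** * Corank of a random alternating matrix *)

Section CorankWalk.
Variables (q : rat) (q_neq0 : q != 0).

(* The expectation of f (corank) over all alternating M x M matrices over F_q: adding
   a row and a column raises a corank c by 1 when the new row lies in the row space
   (probability q^-c) and lowers it by 1 otherwise.  At c = 0 the junk value
   c.-1 = 0 carries the weight 0. *)
Fixpoint walk (M : nat) (f : nat -> rat) : rat :=
  if M is M'.+1 then
    walk M' (fun c => q ^- c * f c.+1 + (1 - q ^- c) * f c.-1)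
  else f 0%N.

Lemma eq_walk M f g : f =1 g -> walk M f = walk M g.
Proof. by elim: M f g => [|M IH] f g fg /=; [exact: fg | apply: IH => c; rewrite !fg]. Qed.

Lemma walk_lin M a f g :
  walk M (fun c => a * f c + g c) = a * walk M f + walk M g.
Proof.
elim: M f g => [//|M IH] f g /=; rewrite -IH; apply: eq_walk => c; ring.
Qed.

Lemma walk_scale M a f : walk M (fun c => a * f c) = a * walk M f.
Proof.
elim: M f => [//|M IH] f /=; rewrite -IH; apply: eq_walk => c; ring.
Qed.

(** For a prime power q, [pprod v c] counts the independent v-tuples in a space of dimension c.
    [eprod] and [oprod] vanish at the first v even and the first v odd values of c. *)
Definition pprod v c : rat := \prod_(i < v) (q ^+ c - q ^+ i).
Definition eprod v c : rat := \prod_(i < v) (q ^+ c - q ^+ i.*2).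
Definition oprod v c : rat := \prod_(i < v) (q ^+ c - q ^+ i.*2.+1).

Lemma prodM_const v (a : rat) (F : 'I_v -> rat) :
  \prod_(i < v) (a * F i) = a ^+ v * \prod_(i < v) F i.
Proof. by rewrite big_split /= prodr_const card_ord. Qed.

Lemma walk_const M a : walk M (fun=> a) = a.
Proof.
by elim: M => [//|M IH] /=; rewrite -[RHS]IH; apply: eq_walk => c; ring.
Qed.

(** One step of the walk turns [pprod v.+1] into a combination of itself and [pprod v]; the product
    solves the resulting recursion in M. *)
Lemma walk_pprod M v :
  walk M (pprod v) = \prod_(i < v) (q ^+ i.+1 * (1 - q ^+ i / q ^+ M)).
Proof.
elim: M v => [|M IH] v.
  rewrite /= /pprod; case: v => [|v]; first by rewrite !big_ord0.
  by rewrite !big_ord_recl /= expr0 divr1 subrr mulr0 !mul0r.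
case: v => [|v].
  by rewrite big_ord0 -[RHS](walk_const M.+1); apply: eq_walk => c; rewrite /pprod big_ord0.
rewrite [LHS]/=.
have step c : q ^- c * pprod v.+1 c.+1 + (1 - q ^- c) * pprod v.+1 c.-1
    = q ^- v.+1 * pprod v.+1 c + (q ^+ v.+1 - 1) * pprod v c.
  have -> : pprod v.+1 c.+1 = (q * q ^+ c - 1) * (q ^+ v * pprod v c).
    rewrite /pprod big_ord_recl expr0 -exprS -prodM_const; congr (_ * _).
    by apply: eq_bigr => i _; rewrite /= /bump /= !exprS mulrBr.
  (* The factor q^c - 1 is the one at i = 0 that the index shift leaves out. At c = 0 both sides
     vanish, which disposes of the junk value of [c.-1]. *)
  have E1 : (q ^+ c - 1) * pprod v.+1 c.-1 = q ^- v.+1 * pprod v.+2 c.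
    rewrite {2}/pprod big_ord_recl expr0; case: c => [|c].
      by rewrite expr0 subrr !mul0r mulr0.
    rewrite mulrCA /pprod -exprVn -prodM_const; congr (_ * _).
    apply: eq_bigr => i _; rewrite /= /bump /= !exprS; field => //.
  have -> : (1 - q ^- c) * pprod v.+1 c.-1 = q ^- c * (q ^- v.+1 * pprod v.+2 c).
    by rewrite -E1; field; rewrite expf_neq0.
  rewrite [pprod v.+2 c]/pprod big_ord_recr /= -/(pprod v.+1 c).
  rewrite [pprod v.+1 c]/pprod big_ord_recr /= -/(pprod v c).
  by rewrite !exprS; field; rewrite ?q_neq0 ?expf_neq0.
rewrite (eq_walk _ _ _ step) walk_lin walk_scale !IH.
rewrite big_ord_recr [in RHS]big_ord_recl /=.
set A := \prod_(i < v) _.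
rewrite [X in _ = _ * X](_ : _ = q ^+ v * A).
  by rewrite !exprS expr0; field; rewrite ?q_neq0 ?expf_neq0.
rewrite /A -prodM_const; apply: eq_bigr => i _.
by rewrite /bump /= !exprS; field; rewrite ?q_neq0 ?expf_neq0.
Qed.

(** Each step changes the parity of the corank, so it sends [eprod] to combinations of [oprod] and
    conversely; both expectations therefore come out of one induction. *)
Lemma walk_even_odd M v :
  walk M (eprod v) = \prod_(i < v) (q * (1 - q ^+ i.*2 / q ^+ M)) /\
  walk M (oprod v) = \prod_(i < v) (1 - q ^+ i.*2.+1 / q ^+ M).
Proof.
elim: M v => [|M IH] v.
  split; rewrite /= /eprod /oprod; last first.
    by apply: eq_bigr => i _; rewrite expr0 divr1.
  case: v => [|v]; first by rewrite !big_ord0.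
  by rewrite !big_ord_recl /= expr0 divr1 subrr mulr0 !mul0r.
split.
  case: v => [|v].
    by rewrite big_ord0 -[RHS](walk_const M.+1); apply: eq_walk => c; rewrite /eprod big_ord0.
  rewrite [LHS]/=.
  have step c : q ^- c * eprod v.+1 c.+1 + (1 - q ^- c) * eprod v.+1 c.-1
      = q ^- v.+1 * oprod v.+1 c + (q ^+ v.+1 - q ^- v.+1) * oprod v c.
    have -> : eprod v.+1 c.+1 = (q * q ^+ c - 1) * (q ^+ v * oprod v c).
      rewrite /eprod big_ord_recl expr0 -exprS -prodM_const; congr (_ * _).
      apply: eq_bigr => i _; rewrite /= /bump /= -mul2n mulnDr -addnn.
      rewrite (_ : (2 * 1 + 2 * i = (i + i).+2)%N); last by lia.
      by rewrite !exprS; ring.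
    have -> : (1 - q ^- c) * eprod v.+1 c.-1
        = q ^- c * (q ^+ c - 1) * (q ^- v.+1 * oprod v.+1 c).
      case: c => [|c]; first by rewrite expr0 invr1 subrr !mulr0 !mul0r.
      rewrite mulrBr mulVf ?mulr1 ?expf_neq0 //; congr (_ * _).
      rewrite -exprVn /oprod -prodM_const; apply: eq_bigr => i _.
      by rewrite !exprS; field.
    rewrite [oprod v.+1 c]/oprod big_ord_recr /= -/(oprod v c) -addnn.
    by rewrite !exprS exprD; field; rewrite ?q_neq0 ?expf_neq0.
  rewrite (eq_walk _ _ _ step) walk_lin walk_scale !(proj2 (IH _)).
  rewrite big_ord_recr [in RHS]big_ord_recl /=.
  set A := \prod_(i < v) _.
  rewrite [X in _ = _ * X](_ : _ = q ^+ v * A).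
    by rewrite -addnn !exprS !exprD expr0; field; rewrite ?q_neq0 ?expf_neq0.
  rewrite /A -prodM_const; apply: eq_bigr => i _.
  rewrite /bump /= -!addnn (_ : (1 + i + (1 + i) = (i + i).+2)%N); last by lia.
  by rewrite !exprS; field; rewrite ?q_neq0 ?expf_neq0.
rewrite [LHS]/=.
have step c : q ^- c * oprod v c.+1 + (1 - q ^- c) * oprod v c.-1
    = q ^- v * eprod v c.
  have -> : oprod v c.+1 = q ^+ v * eprod v c.
    rewrite /oprod -prodM_const; apply: eq_bigr => i _.
    by rewrite !exprS; ring.
  have E1 : (q ^+ c - 1) * oprod v c.-1 = q ^- v * eprod v.+1 c.
    rewrite /eprod big_ord_recl expr0; case: c => [|c].
      by rewrite expr0 subrr !mul0r mulr0.
    rewrite mulrCA /oprod -exprVn -prodM_const; congr (_ * _).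
    apply: eq_bigr => i _; rewrite /= /bump /= -!addnn.
    rewrite (_ : (1 + i + (1 + i) = (i + i).+2)%N); last by lia.
    by rewrite !exprS; field.
  have -> : (1 - q ^- c) * oprod v c.-1 = q ^- c * (q ^- v * eprod v.+1 c).
    by rewrite -E1; field; rewrite expf_neq0.
  rewrite [eprod v.+1 c]/eprod big_ord_recr /= -/(eprod v c) -addnn exprD.
  by field; rewrite !expf_neq0.
rewrite (eq_walk _ _ _ step) walk_scale (proj1 (IH _)).
rewrite -exprVn -prodM_const; apply: eq_bigr => i _.
by rewrite !exprS; field; rewrite ?q_neq0 ?expf_neq0.
Qed.

(** Both families are bases of the polynomials in q^c compatible with the degree, so the moments
    below k in one basis determine those in the other. *)
Lemma moments_transfer (I : finType) (A : {pred I}) (c : I -> nat) M k (w : rat) :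
  (forall v, (v < k)%N -> \sum_(a in A) pprod v (c a) = w * walk M (pprod v)) ->
  forall v, (v < k)%N -> \sum_(a in A) eprod v (c a) = w * walk M (eprod v).
Proof.
move=> H v vk.
(* Mixed products interpolate between the two bases: t factors with nodes q^i and u factors with
   nodes q^(2i). *)
suff G u t : (t + u < k)%N ->
    \sum_(a in A) (pprod t (c a) * \prod_(i < u) (q ^+ c a - q ^+ i.*2))
    = w * walk M (fun s => pprod t s * \prod_(i < u) (q ^+ s - q ^+ i.*2)).
  have := G v 0%N vk; rewrite (eq_bigr (fun a => eprod v (c a))) => [->|a _].
    by congr (_ * _); apply: eq_walk => s; rewrite /pprod big_ord0 mul1r.
  by rewrite /pprod big_ord0 mul1r.
elim: u t => [|u IH] t tu.
  rewrite (eq_bigr (fun a => pprod t (c a))) => [|a _]; last by rewrite big_ord0 mulr1.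
  rewrite H; last by lia.
  by congr (_ * _); apply: eq_walk => s; rewrite big_ord0 mulr1.
pose g t s := pprod t s * \prod_(i < u) (q ^+ s - q ^+ i.*2).
(* Here q^s - q^(2u) = (q^t - q^(2u)) + (q^s - q^t); the second summand is the next factor of
   [pprod]. *)
have E s : pprod t s * \prod_(i < u.+1) (q ^+ s - q ^+ i.*2)
    = (q ^+ t - q ^+ u.*2) * g t s + g t.+1 s.
  by rewrite /g /pprod !big_ord_recr /=; ring.
rewrite (eq_bigr _ (fun a _ => E (c a))) (eq_walk _ _ _ E) walk_lin.
rewrite big_split /= -mulr_sumr /g !IH; [ring|lia|lia].
Qed.

End CorankWalk.

(** * Gaussian inversion *)

Section GaussianInversion.
Variables (Q : nat) (Q_gt1 : (1 < Q)%N).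

Local Notation QQ := (Q%:Q).

Lemma QX_sub1_neq0 i : QQ ^+ i.+1 - 1 != 0.
Proof. by rewrite subr_eq0 gt_eqF // exprn_egt1 // ltr1n. Qed.

Definition qfact a : rat := \prod_(i < a) (QQ ^+ i.+1 - 1).

Lemma qfact_neq0 a : qfact a != 0.
Proof. by apply/prodf_neq0 => i _; exact: QX_sub1_neq0. Qed.

Lemma gbinom_small a b : (a < b)%N -> gbinom Q a b = 0.
Proof.
by move=> ab; rewrite /gbinom (bigD1 (Ordinal ab)) //= subnn subrr !mul0r.
Qed.

Lemma gbinom_qfact a b :
  (b <= a)%N -> gbinom Q a b = qfact a / (qfact b * qfact (a - b)).
Proof.
elim: b => [|b IH] ba.
  by rewrite /gbinom /qfact !big_ord0 mul1r subn0 divff ?qfact_neq0.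
rewrite /gbinom big_ord_recr /= -/(gbinom Q a b) IH; last by lia.
rewrite (_ : (a - b = (a - b.+1).+1)%N); last by lia.
rewrite /qfact [\prod_(i < b.+1) _]big_ord_recr [\prod_(i < _.+1) _]big_ord_recr /=.
rewrite -!/(qfact _) !exprS; field.
by rewrite -!exprS !QX_sub1_neq0 !qfact_neq0.
Qed.

Lemma gbinom_pascal a b :
  gbinom Q a.+1 b.+1 = gbinom Q a b.+1 + QQ ^+ (a - b) * gbinom Q a b.
Proof.
have [ba|ab] := ltnP b a; last first.
  rewrite [gbinom Q a b.+1]gbinom_small // add0r.
  have [->|nab] := eqVneq a b.
    rewrite subnn expr0 mul1r !gbinom_qfact // !subnn.
    by rewrite /qfact !big_ord0 !mulr1 !divff // -/(qfact _) qfact_neq0.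
  by rewrite !gbinom_small ?mulr0 //; lia.
rewrite !gbinom_qfact; try lia.
rewrite subSS (_ : (a - b = (a - b.+1).+1)%N); last by lia.
rewrite /qfact ![\prod_(i < _.+1) _]big_ord_recr /= -!/(qfact _).
have -> : QQ ^+ a.+1 = QQ ^+ (a - b.+1).+1 * QQ ^+ b.+1.
  by rewrite -exprD; congr (_ ^+ _); lia.
have := QX_sub1_neq0 (a - b.+1); have := QX_sub1_neq0 b.
move: (QQ ^+ (a - b.+1).+1) (QQ ^+ b.+1) => u w Hw Hu; field.
by rewrite Hu Hw !qfact_neq0.
Qed.

(** Gauss's q-binomial theorem, by the Pascal rule. At x = -1 the factor i = 0 of the product
    vanishes. *)
Lemma gbinom_alt_sum a (x : rat) :
  \sum_(w < a.+1) x ^+ w * QQ ^+ 'C(w, 2) * gbinom Q a w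
  = \prod_(i < a) (1 + x * QQ ^+ i).
Proof.
elim: a => [|a IH].
  by rewrite big_ord_recr /= /gbinom !big_ord0 !mulr1 add0r.
have gb0 b : gbinom Q b 0 = 1 by rewrite /gbinom big_ord0.
rewrite [in LHS]big_ord_recl /= gb0 expr0 !mulr1.
under eq_bigr => i _ do rewrite /bump /= add1n gbinom_pascal mulrDr.
rewrite big_split /= addrA.
have -> : 1 + \sum_(i < a.+1) x ^+ i.+1 * QQ ^+ 'C(i.+1, 2) * gbinom Q a i.+1
   = \prod_(i < a) (1 + x * QQ ^+ i).
  rewrite -IH [RHS]big_ord_recl /= gb0 expr0 !mulr1.
  congr (_ + _); rewrite big_ord_recr /= [gbinom Q a a.+1]gbinom_small // mulr0 addr0.
  by apply: eq_bigr => i _.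
rewrite [RHS]big_ord_recr /= mulrDr mulr1; congr (_ + _).
rewrite -IH mulr_suml; apply: eq_bigr => i _.
rewrite binS bin1 exprD [x ^+ _.+1]exprS.
have -> : QQ ^+ a = QQ ^+ i * QQ ^+ (a - i).
  by rewrite -exprD subnKC // -ltnS.
by ring.
Qed.

(** The product of the two binomials equals [gbinom Q i j * gbinom Q (i - j) (v - j)]. What remains
    is the q-binomial theorem at x = -1, which gives 0 unless i = j. *)
Lemma gbinom_orthogonal i j k : (i < k)%N ->
  \sum_(j <= v < k) (-1) ^+ (v - j) * QQ ^+ 'C(v - j, 2) * gbinom Q v j * gbinom Q i v
  = (i == j)%:R.
Proof.
move=> ik; have [ij|ji] := ltnP i j.
  rewrite big_nat_cond big1 => [|v]; first by rewrite ltn_eqF.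
  by rewrite andbT => /andP[jv _]; rewrite (gbinom_small i v) ?mulr0 //; lia.
rewrite (big_cat_nat (n := i.+1)) //=; last by lia.
rewrite [X in _ + X]big_nat_cond [X in _ + X]big1 ?addr0 => [|v]; last first.
  by rewrite andbT => /andP[iv _]; rewrite (gbinom_small i v) ?mulr0.
rewrite -{1}[j]add0n big_addn big_mkord subSn //.
transitivity (gbinom Q i j * \sum_(w < (i - j).+1) (-1) ^+ w * QQ ^+ 'C(w, 2) * gbinom Q (i - j) w).
  rewrite mulr_sumr; apply: eq_bigr => w _.
  have wi : (w <= i - j)%N by rewrite -ltnS.
  rewrite addnK !gbinom_qfact; try lia.
  rewrite addnK (_ : (i - (w + j) = i - j - w)%N); last by lia.
  by field; rewrite !qfact_neq0.
rewrite gbinom_alt_sum; have [->|nij] := eqVneq i j.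
  by rewrite subnn big_ord0 mulr1 gbinom_qfact // subnn {3}/qfact big_ord0 mulr1 divff ?qfact_neq0.
have: (0 < i - j)%N by lia.
case: (i - j)%N => // u _.
by rewrite big_ord_recl expr0 mulr1 subrr mul0r mulr0.
Qed.

Lemma gbinom_inversion k (A b : nat -> rat) :
  (forall v, (v < k)%N -> \sum_(i < k) A i * gbinom Q i v = b v) ->
  forall j, (j < k)%N ->
  A j = \sum_(j <= v < k) (-1) ^+ (v - j) * QQ ^+ 'C(v - j, 2) * gbinom Q v j * b v.
Proof.
move=> H j jk.
under eq_big_nat => v /andP[_ vk] do rewrite -H // mulr_sumr.
rewrite exchange_big /=.
transitivity (\sum_(i < k) A i * (i == j :> nat)%:R).
  rewrite (bigD1 (Ordinal jk)) //= eqxx mulr1 big1 ?addr0 // => i ij.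
  by rewrite (_ : (i == j :> nat) = false) ?mulr0 //; apply: negbTE.
apply: eq_bigr => i _; rewrite -(gbinom_orthogonal i j k) // mulr_sumr.
by apply: eq_bigr => v _; ring.
Qed.

Lemma eprod_gbinom v j :
  \prod_(i < v) (QQ ^+ j - QQ ^+ i)
  = gbinom Q j v * \prod_(i < v) (QQ ^+ i * (QQ ^+ i.+1 - 1)).
Proof.
have [jv|vj] := ltnP j v.
  by rewrite gbinom_small // mul0r (bigD1 (Ordinal jv)) //= subrr mul0r.
rewrite /gbinom -big_split /=; apply: eq_bigr => i _.
have ij : (i <= j)%N by apply: leq_trans vj; exact: ltnW.
rewrite -{1}(subnK ij) exprD.
have := QX_sub1_neq0 i; rewrite exprS => h; by field.
Qed.

End GaussianInversion.

(** * Frobenius, traces and characters in characteristic 2 *)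

(** A nonempty fibre of f is a translate of its kernel. *)
Lemma card_preim_additive (V W : finZmodType) (f : V -> W) (S : {set W}) :
  {morph f : x y / x - y} ->
  (#|[set x | f x \in S]| <= #|[set x | f x == 0%R]| * #|S|)%N.
Proof.
move=> fB; rewrite -sum1_card (partition_big f (mem S)) => [|x]; last by rewrite inE.
rewrite mulnC -sum_nat_const; apply: leq_sum => y yS.
have [x0 /eqP fx0|no] := pickP (fun x => f x == y); last first.
  by rewrite big_pred0 // => x; rewrite no andbF.
rewrite sum1_card -(card_imset _ (addIr (- x0))); apply: subset_leq_card.
apply/subsetP => z /imsetP[x]; rewrite inE => /andP[_ /eqP fx] ->.
by rewrite fB fx fx0 subrr.
Qed.

(** Translation by an a in W with chi a different from 1 multiplies the sum by chi a, which forces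
    it to be 0. *)
Lemma sum_character (V : finZmodType) (W : {set V}) (chi : V -> rat) :
  {in W &, forall a b, a - b \in W} -> {morph chi : a b / a + b >-> a * b} ->
  \sum_(w in W) chi w = if [forall w in W, chi w == 1] then #|W|%:R else 0.
Proof.
move=> WB chiD; case: forall_inP => [chi1|].
  by rewrite (eq_bigr (fun=> 1)) ?sumr_const // => w /chi1/eqP.
move/forall_inP; rewrite negb_forall_in => /exists_inP[a aW chia].
have W0 : 0 \in W by rewrite -(subrr a) WB.
have WD b : (b + a \in W) = (b \in W).
  apply/idP/idP => [baW|bW]; first by rewrite -(addrK a b) WB.
  by rewrite -[a]opprK WB // -sub0r WB.
have: \sum_(w in W) chi w = (\sum_(w in W) chi w) * chi a.
  rewrite [LHS](reindex_inj (addIr a)) mulr_suml; apply: eq_big => [b|b _] //.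
move/eqP; rewrite -subr_eq0 -{1}[\sum_(w in W) _]mulr1 -mulrBr mulf_eq0 => /orP[/eqP //|].
by rewrite subr_eq0 eq_sym (negPf chia).
Qed.

Section Char2.
Variables (F : finFieldType) (m : nat).
Hypotheses (m_gt0 : (0 < m)%N) (cardF : #|F| = (2 ^ m)%N).

Lemma char2 : 2 \in [pchar F].
Proof. exact: (card_finPcharP cardF). Qed.

Lemma addxx (x : F) : x + x = 0. Proof. exact: addrr_pchar2 char2 x. Qed.
Lemma oppx (x : F) : - x = x. Proof. exact: oppr_pchar2 char2 x. Qed.
Lemma subx (x y : F) : x - y = x + y. Proof. by rewrite oppx. Qed.
Lemma addx_eq0 (x y : F) : (x + y == 0) = (x == y).
Proof. by rewrite -subx subr_eq0. Qed.

Definition frob t (x : F) := x ^+ (2 ^ t).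

Lemma frobE t x : x ^+ (2 ^ t) = frob t x. Proof. by []. Qed.
Lemma frobD t : {morph frob t : x y / x + y}.
Proof.
move=> x y; apply: exprDn_pchar.
by rewrite pnatX; apply/orP; left; rewrite pnatE //; exact: char2.
Qed.
Lemma frobM t : {morph frob t : x y / x * y}. Proof. by move=> x y; apply: exprMn. Qed.
Lemma frob0 t : frob t 0 = 0. Proof. by rewrite /frob expr0n expn_eq0. Qed.
Lemma frob1 t : frob t 1 = 1. Proof. exact: expr1n. Qed.
Lemma frobB t : {morph frob t : x y / x - y}.
Proof. by move=> x y; rewrite !subx frobD. Qed.
Lemma frobV t x : frob t x^-1 = (frob t x)^-1. Proof. by rewrite /frob exprVn. Qed.
Lemma frob_sum t I (r : seq I) (P : pred I) (f : I -> F) :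
  frob t (\sum_(i <- r | P i) f i) = \sum_(i <- r | P i) frob t (f i).
Proof. exact: (big_morph _ (frobD t) (frob0 t)). Qed.
Lemma frob_comp s t x : frob s (frob t x) = frob (s + t) x.
Proof. by rewrite /frob -exprM -expnD addnC. Qed.
Lemma frob_id x : frob 0 x = x. Proof. by rewrite /frob expr1. Qed.
Lemma frob_mul u t x : frob t x = x -> frob (t * u) x = x.
Proof.
move=> tx; elim: u => [|u IH]; first by rewrite muln0 frob_id.
by rewrite mulnS -frob_comp IH.
Qed.
Lemma frob_period u x : frob (m * u) x = x.
Proof. by apply: frob_mul; rewrite /frob -cardF expf_card. Qed.
Lemma frob_eq0 t x : (frob t x == 0) = (x == 0).
Proof. by rewrite expf_eq0 expn_gt0. Qed.
Lemma frob_inj t : injective (frob t).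
Proof.
by move=> x y /eqP; rewrite -subr_eq0 -frobB frob_eq0 subr_eq0 => /eqP.
Qed.

Lemma mem_subF t x : (x \in subF F t) = (frob t x == x). Proof. by rewrite inE. Qed.
Lemma subF0 t : 0 \in subF F t. Proof. by rewrite mem_subF frob0. Qed.
Lemma subF1 t : 1 \in subF F t. Proof. by rewrite mem_subF frob1. Qed.
Lemma subFD t : {in subF F t &, forall x y, x + y \in subF F t}.
Proof. by move=> x y; rewrite !mem_subF frobD => /eqP-> /eqP->. Qed.
Lemma subFM t : {in subF F t &, forall x y, x * y \in subF F t}.
Proof. by move=> x y; rewrite !mem_subF frobM => /eqP-> /eqP->. Qed.
Lemma subFV t : {in subF F t, forall x, x^-1 \in subF F t}.
Proof. by move=> x; rewrite !mem_subF frobV => /eqP->. Qed.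
Lemma traceD t s : {morph trace F t s : x y / x + y}.
Proof. by move=> x y; rewrite /trace -big_split; apply: eq_bigr => i _; rewrite !frobE frobD. Qed.
Lemma trace0 t s : trace F t s 0 = 0.
Proof. by rewrite /trace big1 // => i _; rewrite frobE frob0. Qed.
Lemma trace_sum t s I (r : seq I) (P : pred I) (f : I -> F) :
  trace F t s (\sum_(i <- r | P i) f i) = \sum_(i <- r | P i) trace F t s (f i).
Proof. exact: (big_morph _ (traceD t s) (trace0 t s)). Qed.

(** Raising to the power 2^t shifts the summands, and the last one wraps around since x^(2^m) =
    x. *)
Lemma trace_frob t s : (t * s = m)%N -> forall u x, trace F t s (frob (t * u) x) = trace F t s x.
Proof.
move=> ts u x; elim: u => [|u IH]; first by rewrite muln0 frob_id.
rewrite mulnS -frob_comp -{}IH; move: (frob _ x) => {}x.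
rewrite /trace; case: s ts => [|s] ts; first by rewrite !big_ord0.
rewrite big_ord_recr big_ord_recl /= !frobE muln0 frob_id frob_comp addrC; congr (_ + _).
  by rewrite addnC -mulnS ts -[m]muln1 frob_period.
by apply: eq_bigr => i _; rewrite !frobE frob_comp /bump /= mulnDr muln1 addnC.
Qed.

Lemma trace_subF t s x : (t * s = m)%N -> trace F t s x \in subF F t.
Proof.
move=> ts; rewrite mem_subF -[X in _ == X](trace_frob t s ts 1) muln1.
by rewrite /trace frob_sum; apply/eqP; apply: eq_bigr => i _; rewrite !frobE !frob_comp addnC.
Qed.

Lemma traceZ t s a x : a \in subF F t -> trace F t s (a * x) = a * trace F t s x.
Proof.
rewrite mem_subF => /eqP aK; rewrite /trace mulr_sumr; apply: eq_bigr => i _.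
by rewrite !frobE frobM frob_mul.
Qed.

Lemma trace_comp s t u x :
  trace F s t (trace F (s * t) u x) = trace F s (t * u) x.
Proof.
rewrite {2}/trace trace_sum /trace; elim: u => [|u IH]; first by rewrite muln0 !big_ord0.
rewrite big_ord_recr /= {}IH mulnS addnC big_split_ord /=; congr (_ + _).
by apply: eq_bigr => i _; rewrite !frobE frob_comp; congr frob; rewrite mulnDr mulnA addnC.
Qed.

(** The trace is a polynomial of degree 2^(t(s-1)), nonzero because its coefficient at X is 1. *)
Lemma card_trace0 t s : (0 < t)%N -> (0 < s)%N ->
  (#|[set x : F | trace F t s x == 0%R]| <= 2 ^ (t * s.-1))%N.
Proof.
case: s => // s t_gt0 _; pose P : {poly F} := \sum_(i < s.+1) 'X^(2 ^ (t * i)).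
have PE x : P.[x] = trace F t s.+1 x.
  by rewrite /P horner_sum; apply: eq_bigr => i _; rewrite hornerXn.
have P_neq0 : P != 0.
  apply/eqP => /(congr1 (fun p : {poly F} => p`_1)); rewrite coef0 coef_sum.
  rewrite big_ord_recl /= muln0 coefXn eqxx big1 ?addr0 => [/eqP|i _]; first by rewrite oner_eq0.
  rewrite coefXn (_ : (1 == 2 ^ (t * bump 0 i))%N = false) //.
  by apply: ltn_eqF; rewrite -{1}(expn0 2) ltn_exp2l // muln_gt0 t_gt0.
have szP : (size P <= (2 ^ (t * s)).+1)%N.
  apply: leq_trans (size_sum _ _ _) _; apply/bigmax_leqP => i _.
  by rewrite size_polyXn ltnS leq_exp2l // leq_mul2l -ltnS ltn_ord orbT.
rewrite -ltnS (leq_trans _ szP) // cardE; apply: max_poly_roots => //; last exact: enum_uniq.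
by apply/allP => x; rewrite mem_enum inE -PE.
Qed.

(** Counting roots gives the upper bound. For the lower one, x -> x^(2^t) - x has the subfield as
    kernel and values of trace 0, so 2^m is at most the size of the subfield times 2^(t(s-1)). *)
Lemma card_subF t s : (0 < t)%N -> (t * s = m)%N -> #|subF F t| = (2 ^ t)%N.
Proof.
move=> t_gt0 ts.
have s_gt0 : (0 < s)%N by move: m_gt0; rewrite -ts muln_gt0 => /andP[].
apply/eqP; rewrite eqn_leq; apply/andP; split.
  have szP : size ('X^(2 ^ t) - 'X : {poly F}) = (2 ^ t).+1.
    by rewrite size_polyDl ?size_polyXn // size_polyN size_polyX ltnS (leq_pexp2l (isT : (0 < 2)%N) t_gt0).
  rewrite -ltnS -szP cardE; apply: max_poly_roots; last exact: enum_uniq.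
    by rewrite -size_poly_eq0 szP.
  apply/allP => x; rewrite mem_enum mem_subF /root !hornerE.
  by rewrite subr_eq0.
have fB : {morph (fun x => frob t x - x) : x y / x - y}.
  by move=> x y /=; rewrite frobB; ring.
have := card_preim_additive _ _ _ [set x : F | trace F t s x == 0] fB.
have -> : [set x | frob t x - x \in [set x : F | trace F t s x == 0]] = setT.
  apply/setP => x; rewrite !inE subx traceD -[X in frob X](muln1 t) trace_frob //.
  by rewrite addxx eqxx.
rewrite cardsT cardF (_ : [set x | frob t x - x == 0] = subF F t); last first.
  by apply/setP => x; rewrite inE subr_eq0 mem_subF.
move=> le; have := leq_trans le (leq_mul (leqnn _) (card_trace0 t s t_gt0 s_gt0)).
rewrite (_ : (m = t + t * s.-1)%N); first by rewrite expnD leq_pmul2r // expn_gt0.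
by rewrite -mulnS prednK.
Qed.

(** For z nonzero the products z y exhaust F, and the trace would have more zeros than its degree
    allows. *)
Lemma trace_nondegenerate t s z : (0 < t)%N -> (0 < s)%N -> (t * s.-1 < m)%N ->
  (forall y, trace F t s (z * y) = 0) -> z = 0.
Proof.
move=> t0 s0 tsm h; apply/eqP/negPn/negP => z0.
have := card_trace0 t s t0 s0.
rewrite (_ : [set x : F | _] = setT); first by rewrite cardsT cardF leq_exp2l // leqNgt tsm.
by apply/setP => x; rewrite !inE -(mulVKf z0 x) mulrC mulrAC -mulrA mulrC -mulrA h eqxx.
Qed.

Definition tr := trace F 1 m.
(** As [tr] takes values in F_2, the additive character is a sign and character sums stay
    rational. *)
Definition psi (z : F) : rat := (-1) ^+ (tr z != 0).

Lemma trE x : tr x = trace F 1 m x. Proof. by []. Qed.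
Lemma trD : {morph tr : x y / x + y}. Proof. exact: traceD. Qed.
Lemma tr_sum I (r : seq I) (P : pred I) (f : I -> F) :
  tr (\sum_(i <- r | P i) f i) = \sum_(i <- r | P i) tr (f i).
Proof. exact: trace_sum. Qed.
Lemma tr0 : tr 0 = 0. Proof. exact: trace0. Qed.
Lemma tr_frob u x : tr (frob u x) = tr x.
Proof. by rewrite -[u]mul1n; apply: trace_frob; rewrite mul1n. Qed.
Lemma tr_nondeg z : (forall y, tr (z * y) = 0) -> z = 0.
Proof. by apply: trace_nondegenerate; rewrite // mul1n prednK. Qed.

Lemma tr01 x : tr x = 0 \/ tr x = 1.
Proof.
have := trace_subF 1 m x (mul1n _); rewrite mem_subF /frob expn1 -/tr.
rewrite -subr_eq0 (_ : tr x ^+ 2 - tr x = tr x * (tr x - 1)); last by ring.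
by rewrite mulf_eq0 subr_eq0 => /orP[]/eqP; [left|right].
Qed.

Lemma psiD : {morph psi : x y / x + y >-> x * y}.
Proof.
move=> x y; rewrite /psi trD.
by case: (tr01 x) => ->; case: (tr01 y) => ->;
   rewrite ?addr0 ?add0r ?addxx ?eqxx ?oner_eq0 ?mulr1 ?mul1r.
Qed.

Lemma psi_eq1 x : (psi x == 1) = (tr x == 0).
Proof. by rewrite /psi; case: (tr x == 0). Qed.

End Char2.

(** * Linear algebra over the subfield of order 2^e *)

(** Joins the finite and the additive structure, so that [sum_character] applies to tuples of
    vectors and to the parameters of the forms. *)
HB.instance Definition _ (I : finType) (V : finZmodType) :=
  GRing.Zmodule.on {ffun I -> V}.

Section FiniteFunctionCons.
Variable F : finFieldType.

Definition fcons v (z : F) (x : {ffun 'I_v -> F}) : {ffun 'I_v.+1 -> F} :=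
  [ffun i => if unlift ord0 i is Some j then x j else z].

Lemma fcons0 v z (x : {ffun 'I_v -> F}) : fcons v z x ord0 = z.
Proof. by rewrite ffunE unlift_none. Qed.

Lemma fconsS v z (x : {ffun 'I_v -> F}) i : fcons v z x (lift ord0 i) = x i.
Proof. by rewrite ffunE liftK. Qed.

Lemma sum_fcons (V : nmodType) v (G : {ffun 'I_v.+1 -> F} -> V) :
  \sum_y G y = \sum_w \sum_y' G (fcons v w y').
Proof.
rewrite pair_big /= (reindex (fun p : F * {ffun 'I_v -> F} => fcons v p.1 p.2)) //=.
exists (fun y : {ffun 'I_v.+1 -> F} => (y ord0, [ffun i => y (lift ord0 i)])) => [[w y]|y] _ /=.
  by rewrite fcons0; congr (_, _); apply/ffunP => i; rewrite ffunE fconsS.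
apply/ffunP => i; case: (unliftP ord0 i) => [j|] ->; last by rewrite fcons0.
by rewrite fconsS ffunE.
Qed.

Lemma fcons_all v z (x : {ffun 'I_v -> F}) (P : pred F) :
  [forall i, P (fcons v z x i)] = P z && [forall i, P (x i)].
Proof.
apply/forallP/andP => [h|[Pz /forallP h] i].
  split; first by have := h ord0; rewrite fcons0.
  by apply/forallP => i; have := h (lift ord0 i); rewrite fconsS.
by case: (unliftP ord0 i) => [j|] ->; rewrite ?fcons0 ?fconsS.
Qed.

End FiniteFunctionCons.

Section LinearAlgebra.
Variables (F : finFieldType) (m e M : nat).
Hypotheses (m_gt0 : (0 < m)%N) (cardF : #|F| = (2 ^ m)%N).
Hypotheses (e_gt0 : (0 < e)%N) (eM : (e * M)%N = m).

Local Notation K := (subF F e).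
Local Notation T := (trace F e M).
Local Notation oppx := (oppx F m cardF).
Local Notation addxx := (addxx F m cardF).
Local Notation frobD := (frobD F m cardF).
Local Notation K0 := (subF0 F e).
Local Notation K1 := (subF1 F e).
Local Notation KD := (subFD F m cardF e).
Local Notation KM := (subFM F e).
Local Notation KV := (subFV F e).

Lemma M_gt0 : (0 < M)%N.
Proof. by move: m_gt0; rewrite -eM muln_gt0 => /andP[]. Qed.

Lemma cardK : #|K| = (2 ^ e)%N.
Proof. exact: (card_subF F m m_gt0 cardF e M). Qed.

Lemma frobK s a : a \in K -> frob F (e * s) a = a.
Proof. by rewrite mem_subF => /eqP /(frob_mul F s). Qed.

Definition Kspan v (x : 'I_v -> F) : {set F} :=
  [set z | [exists c : {ffun 'I_v -> F},
     [forall i, c i \in K] && (z == \sum_i c i * x i)]].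

Lemma spanP v (x : 'I_v -> F) z :
  reflect (exists2 c : 'I_v -> F, forall i, c i \in K & z = \sum_i c i * x i)
          (z \in Kspan v x).
Proof.
rewrite inE; apply: (iffP existsP) => [[c /andP[/forallP cK /eqP ->]]|[c cK ->]].
  by exists c.
exists [ffun i => c i]; apply/andP; split; first by apply/forallP => i; rewrite ffunE.
by apply/eqP; apply: eq_bigr => i _; rewrite ffunE.
Qed.

Lemma lin_indepP v (x : {ffun 'I_v -> F}) :
  reflect (forall c : 'I_v -> F, (forall i, c i \in K) -> \sum_i c i * x i = 0 ->
             forall i, c i = 0)
          (lin_indep F K v x).
Proof.
apply: (iffP forallP) => [h c cK c0 i|h c].
  have := h [ffun i => c i]; rewrite (_ : [forall i, _] = true); last first.
    by apply/forallP => j; rewrite ffunE.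
  rewrite (eq_bigr (fun i => c i * x i)) => [|j _]; last by rewrite ffunE.
  by rewrite c0 eqxx /= => /forallP/(_ i); rewrite ffunE => /eqP.
apply/implyP => /forallP cK; apply/implyP => /eqP c0.
by apply/forallP => i; apply/eqP; apply: h.
Qed.

Lemma span_tail v z (x : {ffun 'I_v -> F}) w :
  reflect (exists2 a, a \in K & w - a * z \in Kspan v x) (w \in Kspan v.+1 (fcons F v z x)).
Proof.
apply: (iffP (spanP _ _ _)) => [[c cK ->]|[a aK /spanP[c cK wE]]].
  exists (c ord0) => //; apply/spanP; exists (fun i => c (lift ord0 i)) => //.
  rewrite big_ord_recl fcons0 addrC addKr; apply: eq_bigr => i _.
  by rewrite fconsS.
exists (fun i => if unlift ord0 i is Some j then c j else a) => [i|].
  by case: unliftP.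
rewrite big_ord_recl unlift_none fcons0 -[LHS](subrK (a * z)) addrC wE; congr (_ + _).
by apply: eq_bigr => i _; rewrite liftK fconsS.
Qed.

Lemma lin_indep_cons v z (x : {ffun 'I_v -> F}) :
  lin_indep F K v.+1 (fcons F v z x) = lin_indep F K v x && (z \notin Kspan v x).
Proof.
apply/lin_indepP/andP => [h|[/lin_indepP h zx] c cK].
  split.
    apply/lin_indepP => c cK c0 i.
    pose c' i := if unlift ord0 i is Some j then c j else 0 : F.
    have <- : c' (lift ord0 i) = c i by rewrite /c' liftK.
    apply: h => [j|]; first by rewrite /c'; case: unliftP => // _; exact: K0.
    rewrite big_ord_recl /c' unlift_none mul0r add0r -[RHS]c0.
    by apply: eq_bigr => j _; rewrite liftK fconsS.
  apply/negP => /spanP[c cK zE].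
  pose c' i := if unlift ord0 i is Some j then c j else 1 : F.
  have /eqP : c' ord0 = 0; last by rewrite /c' unlift_none oner_eq0.
  apply: h => [j|]; first by rewrite /c'; case: unliftP => // _; exact: K1.
  rewrite big_ord_recl /c' unlift_none fcons0 mul1r {1}zE.
  rewrite [X in _ + X](eq_bigr (fun i => c i * x i)) ?addxx // => j _.
  by rewrite liftK fconsS.
rewrite big_ord_recl fcons0.
under eq_bigr => i _ do rewrite fconsS.
have [c0|c0] := eqVneq (c ord0) 0.
  rewrite c0 mul0r add0r => /(h (fun i => c (lift ord0 i)) (fun i => cK _)) h' i.
  by case: (unliftP ord0 i) => [j|] ->.
move=> /eqP; rewrite addr_eq0 oppx => /eqP zE; case/negP: zx.
apply/spanP; exists (fun i => (c ord0)^-1 * c (lift ord0 i)) => [i|].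
  by rewrite KM // KV.
rewrite -(mulKf c0 z) zE mulr_sumr; apply: eq_bigr => i _; by rewrite mulrA.
Qed.

Definition subspace (W : {set F}) :=
  [/\ 0 \in W, {in W &, forall x y, x + y \in W} & {in K & W, forall a x, a * x \in W}].

Lemma subspace_sum W I (r : seq I) (P : pred I) (f : I -> F) : subspace W ->
  (forall i, P i -> f i \in W) -> \sum_(i <- r | P i) f i \in W.
Proof. by case=> W0 WD _ h; elim/big_ind: _. Qed.

Lemma span_sub W v (x : 'I_v -> F) : subspace W ->
  (forall i, x i \in W) -> Kspan v x \subset W.
Proof.
move=> sW xW; apply/subsetP => z /spanP[c cK ->]; apply: subspace_sum => // i _.
by case: sW => _ _; apply.
Qed.

Lemma span_subspace v (x : 'I_v -> F) : subspace (Kspan v x).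
Proof.
split.
- apply/spanP; exists (fun=> 0) => [i|]; first exact: K0.
  by rewrite big1 // => i _; rewrite mul0r.
- move=> y z /spanP[c cK ->] /spanP[c' cK' ->]; apply/spanP.
  exists (fun i => c i + c' i) => [i|]; first by rewrite KD.
  by rewrite -big_split; apply: eq_bigr => i _; rewrite mulrDl.
- move=> a y aK /spanP[c cK ->]; apply/spanP.
  exists (fun i => a * c i) => [i|]; first by rewrite KM.
  by rewrite mulr_sumr; apply: eq_bigr => i _; rewrite mulrA.
Qed.

Lemma card_span v (x : {ffun 'I_v -> F}) :
  lin_indep F K v x -> #|Kspan v x| = ((2 ^ e) ^ v)%N.
Proof.
move=> /lin_indepP xi.
have -> : Kspan v x = [set \sum_i c i * x i | c : {ffun 'I_v -> F} in ffun_on (mem K)].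
  apply/setP => z; apply/spanP/imsetP => [[c cK ->]|[c /ffun_onP cK ->]]; last by exists c.
  exists [ffun i => c i]; first by apply/ffun_onP => i; rewrite ffunE; exact: cK.
  by apply: eq_bigr => i _; rewrite ffunE.
rewrite card_in_imset ?card_ffun_on ?card_ord ?cardK // => c c' /ffun_onP cK /ffun_onP cK' E.
apply/ffunP => i; apply/eqP; rewrite -subr_eq0; apply/eqP.
apply: (xi (fun i => c i - c' i)) => [j|].
  by rewrite oppx KD.
under eq_bigr => j _ do rewrite mulrBl.
by rewrite sumrB E subrr.
Qed.

(** A family attaining the maximum in [dim_over] spans W, since a vector outside its span would
    extend it. *)
Lemma card_subspace W : subspace W -> #|W| = ((2 ^ e) ^ dim_over F K W)%N.
Proof.
move=> sW; set D := dim_over F K W.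
pose P t := [exists v : {ffun 'I_t -> F}, [forall i, v i \in W] && lin_indep F K t v].
(* The cap on t in [dim_over] excludes no independent family: t vectors span q^t > t elements of
   F. *)
have P_lt t : P t -> (t < #|F|.+1)%N.
  case/existsP=> x /andP[_ /card_span xi]; rewrite ltnS ltnW //.
  apply: leq_trans (max_card (Kspan t x)); rewrite xi -expnM.
  by apply: leq_trans (ltn_expl t (ltnSn 1)) _; rewrite leq_exp2l // leq_pmull.
have P0 : P 0%N.
  apply/existsP; exists [ffun=> 0]; apply/andP; split; first by apply/forallP => -[].
  by apply/lin_indepP => c _ _ [].
have PD : P D.
  have [|t Pt E] := eq_bigmax_cond (fun t : 'I_#|F|.+1 => t : nat)
     (A := [pred t : 'I_#|F|.+1 | P t]).
    by apply/card_gt0P; exists (Ordinal (P_lt _ P0)).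
  by move: Pt; rewrite inE -E.
have /existsP[x /andP[/forallP xW xi]] := PD.
rewrite -(card_span D x xi); apply: eq_card => z; apply/idP/idP; last first.
  exact: (subsetP (span_sub W D x sW xW)).
move=> zW; apply/negPn/negP => zx.
have PD1 : P D.+1.
  apply/existsP; exists (fcons F D z x); rewrite lin_indep_cons xi zx !andbT.
  by rewrite (fcons_all _ _ _ _ (fun y => y \in W)) /= zW; apply/forallP.
have := @leq_bigmax_cond _ (fun t : 'I_#|F|.+1 => P t) (fun t => t : nat)
   (Ordinal (P_lt _ PD1)) PD1.
by rewrite -/(dim_over F K W) ltnn.
Qed.

(** Vectors are added one at a time; the new one avoids the q^v elements spanned by the others. *)
Lemma count_indep W v c : subspace W -> #|W| = ((2 ^ e) ^ c)%N ->
  #|[set x : {ffun 'I_v -> F} | lin_indep F K v x && [forall i, x i \in W]]|%:R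
  = pprod (2 ^ e)%:R v c.
Proof.
move=> sW cW; rewrite -sum1_card natr_sum.
elim: v => [|v IH].
  rewrite /pprod big_ord0 (eq_bigl xpredT) => [|x]; last first.
    rewrite !inE; apply/andP; split; last by apply/forallP => -[].
    by apply/lin_indepP => ? _ _ [].
  by rewrite sumr_const card_ffun card_ord expn0.
rewrite big_mkcond sum_fcons exchange_big /= /pprod big_ord_recr /= -/(pprod _ v c) -IH.
rewrite [in RHS]big_mkcond /= mulr_suml; apply: eq_bigr => x _; rewrite !inE.
under eq_bigr => w _ do
  rewrite inE lin_indep_cons (fcons_all _ _ _ _ (fun y => y \in W)).
case: ifP => [/andP[xi xW]|xiW]; last first.
  rewrite mul0r big1 // => w _; case: ifP => // /andP[/andP[xi _] /andP[_ xW]].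
  by rewrite xi xW in xiW.
rewrite mul1r -big_mkcond /= (eq_bigl (mem (W :\: Kspan v x))) => [|w]; last first.
  by rewrite !inE xi xW andbT.
rewrite sumr_const cardsD (setIidPr _); last by apply: span_sub => //; apply/forallP.
rewrite natrB; last by apply: subset_leq_card; apply: span_sub => //; apply/forallP.
by rewrite cW card_span // !natrX.
Qed.

(** Biduality for the trace form, by induction on the number of vectors. *)
Lemma perp_span v (x : {ffun 'I_v -> F}) z :
  (forall u, (forall i, T (x i * u) = 0) -> T (z * u) = 0) -> z \in Kspan v x.
Proof.
elim: v x z => [|v IH] x z h.
  rewrite (_ : z = 0); first by case: (span_subspace 0 x).
  apply: (trace_nondegenerate F m cardF e M) => //; first exact: M_gt0.
    by rewrite -eM ltn_pmul2l // prednK // M_gt0.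
  by move=> y; apply: h => -[].
pose x1 := x ord0; pose x' : {ffun 'I_v -> F} := [ffun i => x (lift ord0 i)].
have xE : x = fcons F v x1 x'.
  apply/ffunP => i; case: (unliftP ord0 i) => [j|] ->; last by rewrite fcons0.
  by rewrite fconsS ffunE.
rewrite xE; apply/span_tail.
have h' u : T (x1 * u) = 0 -> (forall i, T (x' i * u) = 0) -> T (z * u) = 0.
  move=> h1 h2; apply: h => i; rewrite xE.
  by case: (unliftP ord0 i) => [j|] ->; rewrite ?fcons0 ?fconsS.
(* Either some u0 is dual to x1 and orthogonal to the tail, and subtracting T(z u0) x1 reduces to
   the tail; or every u orthogonal to the tail is orthogonal to x1, and the coefficient of x1 can be
   0. *)
have [/existsP[u0 /andP[/forallP u0x /eqP u01]]|no] :=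
  boolP [exists u, [forall i, T (x' i * u) == 0] && (T (x1 * u) == 1)].
  exists (T (z * u0)); first exact: (trace_subF F m cardF).
  apply: IH => u ux.
  have TK := trace_subF F m cardF e M _ eM.
  (* Removing the multiple of u0 makes the test vector orthogonal to x1 as well. *)
  have := h' (u - T (x1 * u) * u0); rewrite !oppx !mulrDr !(traceD _ _ cardF).
  have TZ a b : T (a * (T (x1 * u) * b)) = T (x1 * u) * T (a * b).
    by rewrite mulrCA (traceZ F) ?TK.
  rewrite !TZ u01 mulr1 addxx => /(_ erefl) E.
  rewrite mulrDl (traceD _ _ cardF).
  have -> : T (T (z * u0) * x1 * u) = T (x1 * u) * T (z * u0).
    by rewrite -mulrA (traceZ F) ?TK // mulrC.
  apply: E => i.
  by rewrite mulrDr (traceD _ _ cardF) TZ ux (eqP (u0x i)) mulr0 addr0.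
exists 0; first exact: K0.
rewrite mul0r subr0; apply: IH => u ux; apply: h' => //.
apply/eqP/negPn/negP => t0; case/negP: no; apply/existsP.
have TK := trace_subF F m cardF e M _ eM.
have TZ y : T (y * ((T (x1 * u))^-1 * u)) = (T (x1 * u))^-1 * T (y * u).
  by rewrite mulrCA (traceZ F) ?KV ?TK.
exists ((T (x1 * u))^-1 * u); rewrite TZ mulVf // eqxx andbT.
by apply/forallP => i; rewrite TZ ux mulr0.
Qed.

(* sum_i b(x_i, y_i) = Tr(c * wedge t x y) when b(x, y) = Tr(c(x y^(2^t) + x^(2^t) y)). *)
Definition wedge t v (x y : 'I_v -> F) : F :=
  \sum_i (x i * frob F t (y i) + frob F t (x i) * y i).

(** The coordinates x y^(q^s), s < M, determine the tensor of x and y over F_q, so membership says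
    that the bivector sum_i x_i /\ y_i is 0. *)
Definition wedge_ann v (x : 'I_v -> F) : {set {ffun 'I_v -> F}} :=
  [set y : {ffun 'I_v -> F} | [forall s : 'I_M, wedge (e * s) v x y == 0]].

Lemma wedge_annP v (x : 'I_v -> F) (y : {ffun 'I_v -> F}) :
  reflect (forall s, wedge (e * s) v x y = 0) (y \in wedge_ann v x).
Proof.
rewrite inE; apply: (iffP forallP) => [h s|h s]; last exact/eqP/h.
have /eqP := h (Ordinal (ltn_pmod s M_gt0)); rewrite /= => hs.
have E z : frob F (e * s) z = frob F (e * (s %% M)) z.
  rewrite {1}(divn_eq s M) mulnDr -frob_comp mulnCA eM mulnC.
  exact: (frob_period F m cardF).
by rewrite /wedge; under eq_bigr => i _ do rewrite !E.
Qed.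

(** Multiplying component s by u^(q^s) and summing over s gives sum_j (T(y_j u) x_j + T(x_j u) y_j)
    = 0. If u is orthogonal to all x_j, independence gives T(y_j u) = 0, and [perp_span] applies. *)
Lemma wedge_ann_span v (x y : {ffun 'I_v -> F}) i :
  lin_indep F K v x -> y \in wedge_ann v x -> y i \in Kspan v x.
Proof.
move=> /lin_indepP xi /wedge_annP h; apply: perp_span => u ux.
apply: (xi (fun i => T (y i * u))).
  by move=> j; exact: (trace_subF F m cardF).
have: \sum_(s < M) frob F (e * s) u * wedge (e * s) v x y = 0.
  by rewrite big1 // => s _; rewrite h mulr0.
under eq_bigr => s _ do rewrite /wedge mulr_sumr.
rewrite exchange_big /=.
rewrite (eq_bigr (fun j => T (y j * u) * x j)) // => j _.
transitivity (T (y j * u) * x j + T (x j * u) * y j); last by rewrite ux mul0r addr0.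
rewrite /trace !mulr_suml -big_split /=.
by apply: eq_bigr => s _; rewrite !frobE !frobM; ring.
Qed.

(** Cartan's lemma in counting form: the first entry w of y is any of the q^(v+1) elements of the
    span, and for each w the admissible tails are a translate of the solution set for the remaining
    x_i. *)
Lemma card_wedge_ann v (x : {ffun 'I_v -> F}) :
  lin_indep F K v x -> #|wedge_ann v x| = ((2 ^ e) ^ 'C(v.+1, 2))%N.
Proof.
elim: v x => [|v IH] x.
  move=> _; rewrite (eq_card (B := predT)) ?card_ffun ?card_ord //.
  by move=> y; apply/wedge_annP => s; rewrite /wedge big_ord0.
pose z := x ord0; pose x' : {ffun 'I_v -> F} := [ffun i => x (lift ord0 i)].
have -> : x = fcons F v z x'.
  apply/ffunP => i; case: (unliftP ord0 i) => [j|] ->; last by rewrite fcons0.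
  by rewrite fconsS ffunE.
move: z x' => {}z {}x zxi; have := zxi; rewrite lin_indep_cons => /andP[xi _].
rewrite -sum1_card big_mkcond sum_fcons /=.
transitivity (\sum_(w in Kspan v.+1 (fcons F v z x)) #|wedge_ann v x|)%N; last first.
  by rewrite sum_nat_const card_span // IH // -expnD [in RHS]binS bin1 addnC.
rewrite [RHS]big_mkcond; apply: eq_bigr => w _; case: ifP => wx; last first.
  rewrite big1 // => y' _; case: ifP => // yw.
  by have := wedge_ann_span v.+1 _ _ ord0 zxi yw; rewrite fcons0 wx.
have /span_tail[a aK /spanP[c cK wE]] := wx.
rewrite -sum1_card [RHS]big_mkcond.
(* With w = a z + sum_i c_i x_i, the bivector z /\ w equals sum_i x_i /\ c_i z up to sign, so c_i z
   is moved into the tail. *)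
rewrite [RHS](reindex_inj (addIr [ffun i => c i * z])); apply: eq_bigr => y' _.
congr (if _ then _ else _).
suff E s : wedge (e * s) v.+1 (fcons F v z x) (fcons F v w y')
     = wedge (e * s) v x (y' + [ffun i => c i * z]).
  by apply/wedge_annP/wedge_annP => h s; [rewrite -E | rewrite E].
rewrite /wedge big_ord_recl !fcons0.
under eq_bigr => i _ do rewrite !fconsS.
have E i : frob F (e * s) ((y' + [ffun j => c j * z]) i) =
    frob F (e * s) (y' i) + c i * frob F (e * s) z.
  by rewrite !ffunE frobD frobM (frobK s (c i)).
under [RHS]eq_bigr => i _ do rewrite E !ffunE.
have -> : w = a * z + \sum_i c i * x i by rewrite -wE addrC subrK.
rewrite frobD frobM frobK // (frob_sum F m cardF) !mulrDr !mulr_sumr.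
(* The contribution of z /\ a z cancels in characteristic 2. *)
have -> (p q r : F) : z * (a * frob F (e * s) z) + p + (frob F (e * s) z * (a * z) + q) + r
   = p + q + r.
  rewrite -[RHS]add0r -(addxx (a * z * frob F (e * s) z)); ring.
rewrite -!big_split; apply: eq_bigr => i _ /=; rewrite frobM frobK //; ring.
Qed.

End LinearAlgebra.

(** * Polynomials in a power of the Frobenius *)

Section FrobeniusPolynomials.
Variables (F : finFieldType) (m : nat).
Hypothesis (cardF : #|F| = (2 ^ m)%N).

(* After division by the value at one w, normalized to 1, that term is constant in s;
   differencing in s removes it. *)
Lemma frob_recurrence d (l : seq (F * F)) s0 :
  (forall s, (s0 <= s < s0 + size l)%N -> \sum_(p <- l) p.1 * frob F (d * s) p.2 = 0) ->
  forall s, (s0 <= s)%N -> \sum_(p <- l) p.1 * frob F (d * s) p.2 = 0.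
Proof.
elim: {l}_.+1 {-2}l (ltnSn (size l)) => // r IH [_ _|[c w] l]; first by move=> s; rewrite big_nil.
rewrite /= !ltnS => szl h.
have [w0|w0] := eqVneq w 0.
  move=> s s0s; rewrite big_cons /= w0 frob0 mulr0 add0r; apply: IH s0s => // t /andP[t0 t1].
  have := h t; rewrite big_cons /= w0 frob0 mulr0 add0r; apply; lia.
pose g s := c + \sum_(p <- l) p.1 * frob F (d * s) (p.2 / w).
have gE s : \sum_(p <- (c, w) :: l) p.1 * frob F (d * s) p.2 = frob F (d * s) w * g s.
  rewrite big_cons /= /g mulrDr mulr_sumr mulrC; congr (_ + _).
  apply: eq_bigr => p _; rewrite frobM frobV mulrCA; congr (_ * _).
  by rewrite mulrC mulfVK // frob_eq0.
have g0 s : (s0 <= s < s0 + (size l).+1)%N -> g s = 0.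
  by move=> /h; rewrite gE => /eqP; rewrite mulf_eq0 frob_eq0 (negPf w0) => /eqP.
pose l' := [seq (p.1, frob F d (p.2 / w) - p.2 / w) | p <- l].
have gS s : g s.+1 - g s = \sum_(p <- l') p.1 * frob F (d * s) p.2.
  rewrite /g big_map opprD addrACA subrr add0r -sumrB; apply: eq_bigr => p _ /=.
  by rewrite (frobB F m cardF) frob_comp mulrBr mulnS addnC.
have gS0 s : (s0 <= s)%N -> g s.+1 - g s = 0.
  rewrite gS => s0s; apply: IH s0s => [|t]; first by rewrite size_map.
  rewrite size_map => /andP[t0 t1]; rewrite -gS !g0 ?subrr //.
    by rewrite t0 addnS ltnS ltnW.
  by rewrite leqW //= addnS ltnS.
move=> s s0s; rewrite gE; apply/eqP; rewrite mulf_eq0; apply/orP; right; apply/eqP.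
rewrite -(subnKC s0s); elim: (s - s0)%N => [|t IHt]; first by rewrite addn0 g0 // leqnn addnS ltnS leq_addr.
by rewrite addnS -[LHS](subrK (g (s0 + t)%N)) gS0 ?add0r //; lia.
Qed.

(* Scaling a nonzero root to 1 lets the polynomial be factored through
   t |-> t - t^(2^d), whose kernel is subF F d. *)
Lemma card_frob_roots d r (b : nat -> F) :
  (exists2 s, (s < r)%N & b s != 0) ->
  (#|[set x : F | (\sum_(s < r) b s * frob F (d * s) x == 0)%R]| <= #|subF F d| ^ r.-1)%N.
Proof.
have cKd : (0 < #|subF F d|)%N by apply/card_gt0P; exists 0; exact: subF0.
elim: r b => [|r IH] b [s sr bs]; first by [].
set V := [set x | _]; rewrite [_.+1.-1]/=.
have [/existsP[z /andP[zV z0]]|no] := boolP [exists z, (z \in V) && (z != 0)]; last first.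
  apply: (@leq_trans #|[set (0 : F)]|); last by rewrite cards1 expn_gt0 cKd.
  apply: subset_leq_card; apply/subsetP => z zV; rewrite inE; apply/negPn/negP => z0.
  by case/negP: no; apply/existsP; exists z; rewrite zV.
pose b' s := b s * frob F (d * s) z; pose c s := \sum_(i < s.+1) b' i.
have cr : c r = 0 by move: zV; rewrite inE => /eqP.
(* Abel summation. The boundary term at n = r vanishes because z is a root, and the c_i are the
   coefficients of the quotient polynomial. *)
have abel n t : \sum_(i < n.+1) b' i * frob F (d * i) t =
   \sum_(i < n) c i * frob F (d * i) (t - frob F d t) + c n * frob F (d * n) t.
  elim: n => [|n IHn]; first by rewrite big_ord0 /c !big_ord1 add0r.
  rewrite big_ord_recr /= IHn [in RHS]big_ord_recr /= (frobB F m cardF) frob_comp.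
  by rewrite [c n.+1]/c big_ord_recr /= -/(c n) (_ : (d * n + d = d * n.+1)%N); [ring | lia].
have -> : #|V| = #|[set t | (t - frob F d t) \in
     [set x | \sum_(s < r) c s * frob F (d * s) x == 0]]|.
  rewrite -[RHS](card_imset _ (mulfI z0)); apply: eq_card => x; rewrite inE.
  have E y : (\sum_(s < r.+1) b s * frob F (d * s) (z * y) == 0) =
     (y \in [set t | (t - frob F d t) \in [set x | \sum_(s < r) c s * frob F (d * s) x == 0]]).
    rewrite !inE; congr (_ == _).
    transitivity (\sum_(i < r.+1) b' i * frob F (d * i) y); last first.
      by rewrite abel cr mul0r addr0.
    by apply: eq_bigr => i _; rewrite frobM mulrA.
  apply/idP/imsetP => [xV|[y yV ->]]; last by rewrite E.
  by exists (x / z); rewrite ?(mulrC z) ?divfK // -E mulrC divfK.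
have fB : {morph (fun t => t - frob F d t) : x y / x - y}.
  by move=> x y /=; rewrite (frobB F m cardF); ring.
apply: leq_trans (card_preim_additive _ _ _ _ fB) _.
rewrite (_ : [set x | x - frob F d x == 0] = subF F d); last first.
  by apply/setP => x; rewrite inE subr_eq0 mem_subF eq_sym.
(* The quotient is nonzero: if all partial sums c_i vanished, so would their differences [b' i],
   hence all b_i. *)
have [/existsP[i ci]|no] := boolP [exists i : 'I_r, c i != 0].
  apply: leq_trans (leq_mul (leqnn _) (IH c _)) _; first by exists i.
  by rewrite -expnS prednK //; case: (r) i {ci} => [[]|].
have c0 i : (i <= r)%N -> c i = 0.
  rewrite leq_eqVlt => /predU1P[->//|ir]; apply/eqP/negPn/negP => ci.
  by case/negP: no; apply/existsP; exists (Ordinal ir).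
suff /eqP : b' s = 0 by rewrite mulf_eq0 (negPf bs) frob_eq0 (negPf z0).
case: s sr {bs} => [|s] sr; first by rewrite -(c0 0%N) // /c big_ord1.
by rewrite -(c0 s.+1) // /c big_ord_recr /= -/(c s) c0 ?add0r //; exact: ltnW.
Qed.

End FrobeniusPolynomials.

(** * The forms B_a *)

Section Forms.
Variables (F : finFieldType) (e N D k : nat).
Hypotheses (e_gt0 : (0 < e)%N) (k_gt0 : (0 < k)%N) (kN : (k <= N)%N).
Hypotheses (D_odd : odd D) (DN : coprime D (N + N)).
Local Notation n := (e * N)%N.
Local Notation M := (N + N)%N.
Local Notation m := (e * M)%N.
Local Notation d := (e * D)%N.
Hypothesis (cardF : #|F| = (2 ^ m)%N).

Local Notation K := (subF F e).
Local Notation T := (trace F e M).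
Local Notation tr := (tr F m).
Local Notation psi := (psi F m).
Local Notation frob := (frob F).
Local Notation B := (Bform F n m d e k).
Local Notation rad := (radical F n m d e k).
Local Notation wedge := (wedge F).

Let oppx := oppx F m cardF.
Let addxx := addxx F m cardF.
Let frobD := frobD F m cardF.
Let frobM := frobM F.
Let traceD := traceD F m cardF.
Let trD : {morph tr : x y / x + y} := trD F m cardF.
Let tr_frob := tr_frob F m cardF.

Lemma N_gt0 : (0 < N)%N. Proof. exact: leq_trans k_gt0 kN. Qed.
Lemma m_gt0 : (0 < m)%N. Proof. by rewrite muln_gt0 e_gt0 addn_gt0 N_gt0. Qed.
Let m0 := m_gt0.

Lemma frob_add_period t u x : frob (t + m * u) x = frob t x.
Proof. by rewrite -frob_comp (frob_period F m cardF). Qed.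

(** As D is odd, N d = n + m (D - 1)/2. *)
Lemma frob_half x : frob (N * d) x = frob n x.
Proof.
rewrite (_ : (N * d = n + m * D./2)%N) ?frob_add_period //.
by rewrite -{1}(odd_double_half D) D_odd -addnn; nia.
Qed.

Lemma frob_n_twice x : frob n (frob n x) = x.
Proof. by rewrite frob_comp -mulnDr -[m]muln1 (frob_period F m cardF). Qed.

(** The exponents add up to M, a period of sigma; hence sigma^(N-j) and sigma^(N+j) are adjoint for
    the trace form. *)
Lemma frob_reflect j x : (j <= N)%N -> frob ((N - j) * d) (frob ((N + j) * d) x) = x.
Proof.
move=> jN; rewrite frob_comp -mulnDl (_ : (N - j + (N + j) = M)%N); last by lia.
by rewrite (_ : (M * d = m * D)%N) ?(frob_period F m cardF) //; nia.
Qed.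

(** The multiplier u is an inverse of D modulo M, so sigma generates the powers of x -> x^q. *)
Lemma frob_e_as_d : exists u, forall s x, frob (e * s) x = frob (d * (u * s)) x.
Proof.
have D0 : (0 < D)%N by case: D D_odd.
case: (egcdnP M D0) => u w; rewrite (eqP DN) => E _.
exists u => s x; rewrite (_ : (d * (u * s) = e * s + m * (w * s))%N) ?frob_add_period //.
by rewrite mulnA -(mulnA e D u) (mulnC D u) E; nia.
Qed.

Lemma subF_d : subF F d = K.
Proof.
apply/setP => x; rewrite !mem_subF; apply/eqP/eqP => [dx|]; last exact: frob_mul.
have [u uE] := frob_e_as_d.
by rewrite -{2}(frob_mul F u d x dx) -[u in RHS]muln1 -uE muln1.
Qed.

(* L_a, with B_a(x, y) = Tr(L_a(x) y). *)
Definition lin_op (a : {ffun 'I_k.+1 -> F}) (x : F) : F :=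
  a ord0 * frob n x + \sum_(1 <= j < k)
    (a (inord j) * frob ((N - j) * d) x + frob ((N + j) * d) (a (inord j) * x)).

Lemma trace_half x : T x = trace F e N (x + frob n x).
Proof.
rewrite traceD /trace big_split_ord /=; congr (_ + _).
by apply: eq_bigr => i _; rewrite !frobE frob_comp mulnDr addnC.
Qed.

(** In the terms with j > 0, sigma^(N-j) is moved off y to its adjoint. In the first one, the two
    summands are conjugate over F_{2^n} because a_0 lies there, and [trace_half] merges them. *)
Lemma Bform_lin_op (a : {ffun 'I_k.+1 -> F}) x y : a ord0 \in subF F n -> B a x y = T (lin_op a x * y).
Proof.
rewrite mem_subF => /eqP a0; rewrite /Bform /lin_op mulrDl traceD.
rewrite !mulKn // -mulnA mulKn // !frobE !frob_half; congr (_ + _).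
  rewrite trace_half !frobM a0 frob_n_twice; congr (trace F e N _); ring.
rewrite mulr_suml (trace_sum F m cardF).
apply: eq_big_nat => j /andP[_ jk]; rewrite !frobE mulrDr mulrDl !traceD addrC.
congr (_ + _); first by congr (T _); ring.
rewrite -[RHS](trace_frob F m cardF e M erefl ((N - j) * D)).
rewrite (_ : (e * ((N - j) * D) = (N - j) * d)%N); last by rewrite mulnCA.
by rewrite frobM frob_reflect ?mulrA //; exact: leq_trans (ltnW jk) kN.
Qed.

Lemma BformC a x y : B a x y = B a y x.
Proof.
rewrite /Bform; congr (trace F e _ _ + _); first by ring.
by apply: eq_bigr => j _; congr (trace F e _ _); ring.
Qed.

Lemma Bform_alt a x : B a x x = 0.
Proof.
rewrite /Bform [x * _]mulrC addxx mulr0 trace0 add0r big1 // => j _.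
by rewrite [x * _]mulrC addxx mulr0 trace0.
Qed.

Lemma lin_opD a : {morph lin_op a : x y / x + y}.
Proof.
move=> x y; rewrite /lin_op frobD mulrDr addrACA -big_split /=; congr (_ + _).
by apply: eq_bigr => j _; rewrite mulrDr !frobD mulrDr addrACA.
Qed.

Lemma lin_opZ a c x : c \in K -> lin_op a (c * x) = c * lin_op a x.
Proof.
move=> cK; have fc t : frob (t * d) c = c by rewrite mulnCA frobK.
rewrite /lin_op frobM frobK // mulrDr mulrCA mulr_sumr; congr (_ + _).
by apply: eq_bigr => j _; rewrite !frobM !fc; ring.
Qed.

Lemma lin_op_addl a b x : lin_op (a + b) x = lin_op a x + lin_op b x.
Proof.
rewrite /lin_op ffunE mulrDl addrACA -big_split /=; congr (_ + _).
by apply: eq_bigr => j _; rewrite ffunE !mulrDl frobD addrACA.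
Qed.

Lemma radicalE (a : {ffun 'I_k.+1 -> F}) : a ord0 \in subF F n -> rad a = [set x | lin_op a x == 0].
Proof.
move=> a0; apply/setP => x; rewrite !inE; apply/forallP/eqP => [h|h y].
  apply: (trace_nondegenerate F m cardF e M) => //; first by rewrite addn_gt0 N_gt0.
    by rewrite ltn_pmul2l // prednK // addn_gt0 N_gt0.
  by move=> y; rewrite -Bform_lin_op //; apply/eqP.
by rewrite Bform_lin_op // h mul0r trace0.
Qed.

Lemma radical_subspace (a : {ffun 'I_k.+1 -> F}) : a ord0 \in subF F n -> subspace F e (rad a).
Proof.
move=> a0; rewrite radicalE //; split.
- by have := lin_opZ a 0 0 (subF0 F e); rewrite inE !mul0r => ->.
- by move=> x y; rewrite !inE lin_opD => /eqP-> /eqP->; rewrite addr0.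
- by move=> c x cK; rewrite !inE lin_opZ // => /eqP->; rewrite mulr0.
Qed.

Lemma card_radical (a : {ffun 'I_k.+1 -> F}) : a ord0 \in subF F n ->
  #|rad a| = ((2 ^ e) ^ dim_over F K (rad a))%N.
Proof. by move=> a0; apply: (card_subspace F m e M) => //; exact: radical_subspace. Qed.

(** * Equidistribution of the forms by character sums *)

Lemma tr_lin_op_wedge a v (x y : 'I_v -> F) :
  tr (\sum_i lin_op a (x i) * y i) =
  tr (a ord0 * \sum_i frob n (x i) * y i)
  + \sum_(1 <= j < k) tr (a (inord j) * wedge ((N - j) * d) v x y).
Proof.
rewrite /lin_op; under eq_bigr => i _ do rewrite mulrDl mulr_suml.
rewrite big_split trD /= mulr_sumr; congr (tr _ + _).
  by apply: eq_bigr => i _; rewrite mulrA.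
rewrite exchange_big /= (tr_sum F m cardF).
apply: eq_big_nat => j /andP[_ jk]; rewrite /wedge mulr_sumr.
rewrite !(tr_sum F m cardF); apply: eq_bigr => i _.
rewrite mulrDl mulrDr !trD addrC; congr (_ + _); last by rewrite mulrA.
rewrite -[LHS](tr_frob ((N - j) * d)) frobM frob_reflect ?mulrA //.
exact: leq_trans (ltnW jk) kN.
Qed.

(** The coefficient g of a_0 is paired only with elements of F_{2^n}, so only g + g^(2^n) is
    detected; this is the middle component of the bivector. *)
Lemma wedge_half v (x y : 'I_v -> F) :
  wedge n v x y = \sum_i frob n (x i) * y i + frob n (\sum_i frob n (x i) * y i).
Proof.
rewrite (frob_sum F m cardF) -big_split; apply: eq_bigr => i _ /=.
by rewrite frobM frob_n_twice addrC.
Qed.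

(** Components N - j and N + j are conjugate, so k conditions amount to 2k - 1 consecutive ones. *)
Lemma wedge_reflect v (x y : 'I_v -> F) j : (j <= N)%N ->
  frob ((N - j) * d) (wedge ((N + j) * d) v x y) = wedge ((N - j) * d) v x y.
Proof.
move=> jN; rewrite (frob_sum F m cardF); apply: eq_bigr => i _.
by rewrite frobD !frobM !frob_reflect // addrC.
Qed.

(** The components form a sequence with 2v <= 2k - 2 terms that vanishes at 2k - 1 consecutive
    exponents; [frob_recurrence] and periodicity extend this to all exponents. *)
Lemma wedge_recurrence v (x y : {ffun 'I_v -> F}) : (v < k)%N ->
  (forall j, (j < k)%N -> wedge ((N - j) * d) v x y = 0) ->
  y \in wedge_ann F e M v x.
Proof.
move=> vk h; pose l := [seq (x i, y i) | i <- enum 'I_v] ++ [seq (y i, x i) | i <- enum 'I_v].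
have lE s : \sum_(p <- l) p.1 * frob (d * s) p.2 = wedge (d * s) v x y.
  rewrite big_cat !big_map -enumT !big_enum /= -big_split.
  by apply: eq_bigr => i _ /=; rewrite (mulrC (y i)).
have all0 s : (N - k.-1 <= s)%N -> wedge (d * s) v x y = 0.
  rewrite -lE; apply: (frob_recurrence F m cardF) => t.
  rewrite lE size_cat !size_map -enumT size_enum_ord (mulnC d) => /andP[t0 t1].
  have [tN|Nt] := leqP t N.
    by rewrite -(subKn tN) h //; lia.
  apply/eqP; rewrite -(frob_eq0 F ((N - (t - N)) * d)).
  rewrite -{2}(subnKC (ltnW Nt)) wedge_reflect ?h //; lia.
apply/(wedge_annP F m e M) => // s; have [u uE] := frob_e_as_d.
(* Adding a multiple of the period M passes the threshold N - k + 1. *)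
rewrite -(all0 (u * s + M * N)%N); last by nia.
rewrite (_ : (d * (u * s + M * N) = d * (u * s) + m * (D * N))%N); last by nia.
by apply: eq_bigr => i _; rewrite !frob_add_period !uE.
Qed.

Definition forms : {set {ffun 'I_k.+1 -> F}} := [set a : {ffun 'I_k.+1 -> F} | a ord0 \in subF F n].

(** If all components vanish, the terms with j > 0 drop out and a_0 g is fixed by the Frobenius of
    exponent n, so its absolute trace is twice a half sum, hence 0. *)
Lemma forms_annihilator v (x y : {ffun 'I_v -> F}) : (v < k)%N ->
  [forall a in forms, psi (\sum_i lin_op a (x i) * y i) == 1] = (y \in wedge_ann F e M v x).
Proof.
move=> vk; apply/forall_inP/idP => [h|/(wedge_annP F m e M m0 cardF erefl) h a]; last first.
  rewrite inE mem_subF => /eqP a0; rewrite psi_eq1 tr_lin_op_wedge [X in _ + X]big1 => [|j _]; last first.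
    by rewrite (mulnCA _ e) h mulr0 (tr0 F m).
  set g := \sum_i _; have gn : frob n g = g.
    by apply/eqP; rewrite -(addx_eq0 F m cardF) addrC -wedge_half h.
  rewrite addr0 trE /trace mulnDr big_split_ord /= addrC; apply/eqP.
  rewrite -[RHS](addxx (\sum_(i < n) (a ord0 * g) ^+ (2 ^ (1 * i)))); congr (_ + _).
  by apply: eq_bigr => i _; rewrite !frobE !mul1n addnC -frob_comp frobM a0 gn.
(* Forms with a single nonzero coefficient isolate the components one by one. *)
pose single (i : 'I_k.+1) c : {ffun 'I_k.+1 -> F} := [ffun j => if j == i then c else 0].
apply: wedge_recurrence => // -[_|j jk].
  rewrite subn0; have -> : wedge (N * d) v x y = wedge n v x y.
    by apply: eq_bigr => i _; rewrite !frob_half.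
  apply: (tr_nondeg F m m0 cardF) => c.
  (* The element c + c^(2^n) lies in F_{2^n}, and its product with g has the same trace as c (g +
     g^(2^n)). *)
  have := h (single ord0 (c + frob n c)); rewrite inE ffunE eqxx mem_subF.
  rewrite frobD frob_n_twice addrC eqxx => /(_ isT).
  rewrite psi_eq1 tr_lin_op_wedge ffunE eqxx big_nat_cond [X in _ + X]big1 => [|j]; last first.
    case/andP=> /andP[j0 jk] _; rewrite ffunE (_ : (inord j == ord0) = false) ?mul0r ?(tr0 F m) //.
    by apply/negbTE; rewrite -val_eqE /= inordK -?lt0n // ltnS ltnW.
  rewrite addr0 wedge_half; set g := \sum_i _ => /eqP E.
  rewrite -[RHS]E !mulrDl !trD [c * g]mulrC; congr (_ + _).
  by rewrite -(tr_frob n) frobM frob_n_twice mulrC.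
apply: (tr_nondeg F m m0 cardF) => c.
have jk1 : (j.+1 < k.+1)%N by exact: ltnW.
have := h (single (inord j.+1) c); rewrite inE ffunE (_ : (ord0 == inord j.+1) = false); last first.
  by apply/negbTE; rewrite -val_eqE /= inordK.
rewrite (subF0 F) => /(_ isT).
rewrite psi_eq1 tr_lin_op_wedge ffunE (_ : (ord0 == inord j.+1) = false); last first.
  by apply/negbTE; rewrite -val_eqE /= inordK.
rewrite mul0r (tr0 F m) add0r (bigD1_seq j.+1) ?iota_uniq ?mem_index_iota //=.
rewrite big1_seq => [|i]; last first.
  rewrite mem_index_iota => /andP[ij /andP[i0 ik]].
  rewrite ffunE (_ : (inord i == inord j.+1) = false).
    by rewrite mul0r (tr0 F m).
  by apply/negbTE; rewrite -val_eqE /= !inordK // ltnS ltnW.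
by rewrite addr0 ffunE eqxx mulrC => /eqP.
Qed.

Lemma formsB : {in forms &, forall a b, a - b \in forms}.
Proof.
move=> a b; rewrite !inE !ffunE !frobE (frobB F m cardF) => /eqP-> /eqP->.
by rewrite eqxx.
Qed.

(** The double sum of psi over a and y is evaluated twice: summing over y first selects the a whose
    operator kills all x_i, summing over a first selects the y in [wedge_ann]. *)
Lemma card_forms_vanishing v (x : {ffun 'I_v -> F}) : (v < k)%N -> lin_indep F K v x ->
  #|[set a in forms | [forall i, lin_op a (x i) == 0]]|%:R * ((2 ^ e)%:R ^+ M) ^+ v
  = #|forms|%:R * (2 ^ e)%:R ^+ 'C(v.+1, 2) :> rat.
Proof.
move=> vk xi.
have chiD a : {morph (fun y : {ffun 'I_v -> F} => psi (\sum_i lin_op a (x i) * y i)) :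
    y z / y + z >-> y * z}.
  move=> y z /=; rewrite -(psiD F m cardF) -big_split; congr (psi _).
  by apply: eq_bigr => i _ /=; rewrite ffunE mulrDr.
have chiDa y : {morph (fun a => psi (\sum_i lin_op a (x i) * y i)) : a b / a + b >-> a * b}.
  move=> a b /=; rewrite -(psiD F m cardF) -big_split; congr (psi _).
  by apply: eq_bigr => i _ /=; rewrite lin_op_addl mulrDl.
have all1 a : [forall y in [set: {ffun 'I_v -> F}], psi (\sum_i lin_op a (x i) * y i) == 1]
    = [forall i, lin_op a (x i) == 0].
  apply/forall_inP/forallP => [h i|h y _]; last first.
    by rewrite psi_eq1 big1 ?(tr0 F m) // => i _; rewrite (eqP (h i)) mul0r.
  apply/eqP; apply: (tr_nondeg F m m0 cardF) => c.
  have := h [ffun j => if j == i then c else 0] (in_setT _).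
  rewrite psi_eq1 (bigD1 i) //= ffunE eqxx big1 ?addr0 => [/eqP //|j ji].
  by rewrite ffunE (negPf ji) mulr0.
have qE t : ((2 ^ e) ^ t)%:R = (2 ^ e)%:R ^+ t :> rat by rewrite !natrX.
transitivity (\sum_(a in forms) \sum_(y in [set: {ffun 'I_v -> F}])
    psi (\sum_i lin_op a (x i) * y i)).
  have S a : \sum_(y in [set: {ffun 'I_v -> F}]) psi (\sum_i lin_op a (x i) * y i)
      = if [forall i, lin_op a (x i) == 0] then ((2 ^ e)%:R ^+ M) ^+ v else 0.
    rewrite sum_character ?all1 => [|y z _ _|y z]; [|by rewrite inE|exact: chiD].
    by rewrite cardsT card_ffun card_ord cardF expnM -!qE natrX.
  rewrite (eq_bigr _ (fun a _ => S a)) -big_mkcondr /=.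
  rewrite -sum1_card natr_sum mulr_suml; apply: eq_big => [a|a _]; last by rewrite mul1r.
  by rewrite inE.
rewrite exchange_big /=.
transitivity (\sum_(y in wedge_ann F e M v x) (#|forms|%:R : rat)).
  rewrite [RHS]big_mkcond; apply: eq_big => [y|y _]; first by rewrite inE.
  by rewrite sum_character ?forms_annihilator //; exact: formsB.
by rewrite sumr_const (card_wedge_ann F m e M) // -qE mulr_natr.
Qed.

(** Both sides count pairs of a form and an independent v-tuple in its radical; by the previous
    count every tuple lies in equally many radicals. *)
Lemma sum_pprod_forms v : (v < k)%N ->
  \sum_(a in forms) pprod (2 ^ e)%:R v (dim_over F K (rad a))
  = #|forms|%:R * walk (2 ^ e)%:R M (pprod (2 ^ e)%:R v).
Proof.
move=> vk; set q : rat := (2 ^ e)%:R.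
have q0 : q != 0 by rewrite pnatr_eq0 expn_eq0.
pose P := [set x : {ffun 'I_v -> F} | lin_indep F K v x].
transitivity (\sum_(a in forms) \sum_(x in P)
    ([forall i, lin_op a (x i) == 0]%:R : rat)).
  apply: eq_bigr => a; rewrite inE => a0.
  rewrite -(count_indep F m e M m0 cardF e_gt0 erefl (rad a)); last first.
  - exact: card_radical.
  - exact: radical_subspace.
  rewrite -sum1_card natr_sum [RHS]big_mkcond [LHS]big_mkcond; apply: eq_bigr => x _.
  rewrite radicalE // !inE; case: (lin_indep _ _ _ _) => //=.
  rewrite (eq_forallb (fun i => in_set (fun y => lin_op a y == 0) (x i))).
  by case: ifP.
rewrite exchange_big /=.
transitivity (\sum_(x in P)
    (#|forms|%:R * q ^+ 'C(v.+1, 2) / (q ^+ M) ^+ v)).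
  apply: eq_bigr => x; rewrite inE => xi; rewrite -(card_forms_vanishing v x vk xi) mulfK ?expf_neq0 //.
  rewrite -sum1_card natr_sum big_mkcond [RHS]big_mkcond; apply: eq_bigr => a _.
  by rewrite inE; case: (a \in forms) => //=; case: ifP.
rewrite sumr_const -[LHS]mulr_natl.
have -> : #|P|%:R = pprod q v M.
  rewrite -(count_indep F m e M m0 cardF e_gt0 erefl [set: F]).
  - congr (_%:R); apply: eq_card => x; rewrite !inE andb_idr // => _.
    by apply/forallP => i; rewrite inE.
  - by split=> [|? ? _ _|? ? _ _]; rewrite inE.
  - by rewrite cardsT cardF expnM.
rewrite walk_pprod // /pprod mulrA mulrCA -mulrA; congr (_ * _).
elim: (v) => [|w IH]; first by rewrite !big_ord0 !expr0 divr1 mul1r.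
rewrite !big_ord_recr /= -IH (_ : 'C(w.+2, 2) = 'C(w.+1, 2) + w.+1)%N; last by rewrite binS bin1.
have: q ^+ M != 0 by rewrite expf_neq0.
move: (q ^+ M) ('C(w.+1, 2)) => Q c Q0.
by rewrite exprD !exprS; field; rewrite ?expf_neq0 ?Q0.
Qed.

(** * Dimension and parity of the radical *)

Lemma card_kernel_bound (a : {ffun 'I_k.+1 -> F}) (i : 'I_k.+1) : (i < k)%N -> a i != 0 ->
  (#|[set x | lin_op a x == 0%R]| <= (2 ^ e) ^ (k.-1).*2)%N.
Proof.
move=> ik ai.
set k' := k.-1; have k'k : k'.+1 = k by rewrite prednK.
have k'N : (k' < N)%N by rewrite k'k.
clearbody k'.
(* These are the coefficients of L_a after sigma^(N-k') is factored out, with k' = k - 1: place s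
   stands for the exponent N - k' + s, so a_j sits at k' - j and its conjugate at k' + j. *)
pose b s := if (s <= k')%N then a (inord (k' - s))
            else frob ((N + (s - k')) * d) (a (inord (s - k'))).
have b_lo j : (j <= k')%N -> b (k' - j)%N = a (inord j).
  by move=> jk; rewrite /b leq_subr subKn.
have b_hi j : b (k'.+1 + j)%N = frob ((N + j.+1) * d) (a (inord j.+1)).
  by rewrite /b leqNgt ltnS addSn -addnS leq_addr /= addKn.
have LE x : lin_op a x = \sum_(s < k'.+1 + k') b s * frob (d * s) (frob (d * (N - k')) x).
  rewrite big_split_ord /= /lin_op.
  rewrite [X in _ = X + _](reindex_inj rev_ord_inj) /= big_ord_recl /= -addrA.
  rewrite big_add1 (_ : k.-1 = k') -?k'k //= big_mkord big_split /= subSS; congr (_ + _).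
    rewrite b_lo // frob_comp -mulnDr subn0 (_ : (k' + (N - k') = N)%N); last by lia.
    by rewrite [(d * N)%N]mulnC frob_half; congr (a _ * _); apply/val_inj; rewrite /= inordK.
  congr (_ + _); apply: eq_bigr => j _; have jk : (j < k')%N := ltn_ord j.
    rewrite /bump /= add1n subSS b_lo // frob_comp -mulnDr; congr (_ * frob _ x).
    by rewrite mulnC; congr (_ * _)%N; lia.
  rewrite frobM b_hi frob_comp -mulnDr; congr (_ * frob _ x).
  by rewrite mulnC; congr (_ * _)%N; lia.
pose S := [set x : F | \sum_(s < k'.+1 + k') b s * frob (d * s) x == 0].
have cS : (#|S| <= #|subF F d| ^ (k'.+1 + k').-1)%N.
  have ik' : (i <= k')%N by lia.
  apply: (card_frob_roots F m cardF); exists (k' - i)%N; first by lia.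
  by rewrite b_lo // (_ : inord i = i) //; apply/val_inj; rewrite /= inordK.
rewrite subF_d (cardK F m e M m0 cardF e_gt0 erefl) addSn addnn /= in cS.
apply: leq_trans cS; rewrite -(card_imset _ (frob_inj F m cardF (d * (N - k')))).
apply: subset_leq_card; apply/subsetP => y /imsetP[x]; rewrite inE LE => Sx ->.
by rewrite inE.
Qed.

Lemma tr_tower z : tr z = trace F 1 e (T z).
Proof. by have := trace_comp F m cardF 1 e M z; rewrite mul1n => ->. Qed.

Lemma tr_lin_opC (a : {ffun 'I_k.+1 -> F}) x y : a ord0 \in subF F n -> tr (lin_op a x * y) = tr (lin_op a y * x).
Proof.
by move=> a0; rewrite !tr_tower -!Bform_lin_op // BformC.
Qed.

Lemma tr_lin_op_alt (a : {ffun 'I_k.+1 -> F}) x : a ord0 \in subF F n -> tr (lin_op a x * x) = 0.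
Proof.
by move=> a0; rewrite tr_tower -Bform_lin_op // Bform_alt trace0.
Qed.

Definition isotropic (a : {ffun 'I_k.+1 -> F}) (W : {set F}) := {in W &, forall x y, tr (lin_op a x * y) = 0}.

(** A vector y outside W and orthogonal to W can be adjoined with its F_q-line, because the form is
    alternating; the process stops as F is finite. *)
Lemma maximal_isotropic (a : {ffun 'I_k.+1 -> F}) : a ord0 \in subF F n ->
  exists2 W, subspace F e W /\ isotropic a W &
    forall y, (forall w, w \in W -> tr (lin_op a w * y) = 0) -> y \in W.
Proof.
move=> a0.
have: exists2 W, subspace F e W & isotropic a W.
  exists [set 0] => [|x y]; last first.
    by rewrite !inE => /eqP-> /eqP->; rewrite mulr0 (tr0 F m).
  split=> [|x y|c x _]; first by rewrite inE.
    by rewrite !inE => /eqP-> /eqP->; rewrite addr0.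
  by rewrite !inE => /eqP->; rewrite mulr0.
case=> W; elim: {W}_.+1 {-2}W (ltnSn (#|F| - #|W|)) => // r IH W Wr sW iW.
have [/existsP[y /andP[yW /forall_inP yP]]|no] :=
  boolP [exists y, (y \notin W) && [forall w in W, tr (lin_op a w * y) == 0]]; last first.
  exists W => // y yP; apply/negPn/negP => yW; case/negP: no.
  by apply/existsP; exists y; rewrite yW; apply/forall_inP => w /yP->.
have [W0 WD WZ] := sW.
pose W' := [set w + c * y | w in W, c in K].
have WW' : W \subset W'.
  apply/subsetP => w wW; apply/imset2P; exists w 0 => //; first exact: subF0.
  by rewrite mul0r addr0.
have yW' : y \in W'.
  by apply/imset2P; exists 0 1; rewrite ?subF1 // mul1r add0r.
apply: (IH W').
- have WW : (#|W| < #|W'|)%N.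
    by apply: proper_card; apply/properP; split=> //; exists y.
  apply: leq_trans (ltn_sub2l (leq_trans WW (max_card _)) WW) _.
  by rewrite -ltnS.
- split; first exact: (subsetP WW').
    move=> _ _ /imset2P[w c wW cK ->] /imset2P[w' c' wW' cK' ->].
    apply/imset2P; exists (w + w') (c + c'); [exact: WD|exact: (subFD F m cardF)|ring].
  move=> b _ bK /imset2P[w c wW cK ->].
  apply/imset2P; exists (b * w) (b * c); [exact: WZ|exact: subFM|ring].
move=> _ _ /imset2P[w c wW cK ->] /imset2P[w' c' wW' cK' ->].
have cross u b : u \in W -> b \in K -> tr (lin_op a u * (b * y)) = 0.
  by move=> uW bK; rewrite mulrA [_ * b]mulrC -lin_opZ //; apply/eqP/yP/WZ.
rewrite lin_opD mulrDl !mulrDr !trD iW // cross // tr_lin_opC // cross // !add0r.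
(* l is the square root of c c' in F_q, so the pairing of c y with c' y is that of l y with
   itself. *)
pose l := frob e.-1 (c * c').
have lK : l \in K.
  rewrite mem_subF frob_comp addnC -frob_comp; apply/eqP; congr (frob _ _).
  by apply/eqP; rewrite -mem_subF subFM.
have ll : l * l = c * c'.
  have := subFM F e c c' cK cK'; rewrite mem_subF => /eqP E.
  by rewrite -[RHS]E -(prednK e_gt0) -add1n -frob_comp -frobE expn1 expr2.
rewrite lin_opZ // -[RHS](tr_lin_op_alt a (l * y) a0) lin_opZ //; congr (tr _).
transitivity (c * c' * (lin_op a y * y)); first by ring.
by rewrite -ll; ring.
Qed.

(* A maximal isotropic subspace W equals its orthogonal, so |W|^2 = |F| |rad B_a|. *)
Lemma radical_dim_even (a : {ffun 'I_k.+1 -> F}) : a ord0 \in subF F n -> ~~ odd (dim_over F K (rad a)).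
Proof.
move=> a0; have [W [sW iW] maxW] := maximal_isotropic a a0.
have [W0 WD WZ] := sW.
have kerW : rad a \subset W.
  rewrite radicalE //; apply/subsetP => x; rewrite inE => /eqP x0.
  by apply: maxW => w wW; rewrite tr_lin_opC // x0 mul0r (tr0 F m).
have : (#|W|%:R * #|W|%:R = #|F|%:R * #|rad a|%:R :> rat).
  (* Summing over w first detects the y orthogonal to W, which form W itself; summing over y first
     detects the w in the radical. *)
  transitivity (\sum_(y : F) \sum_(w in W) psi (lin_op a w * y)).
    transitivity (\sum_(y in W) (#|W|%:R : rat)); first by rewrite sumr_const mulr_natr.
    rewrite big_mkcond; apply: eq_bigr => y _.
    rewrite sum_character => [|u w uW wW|u w]; last first.
    - by rewrite lin_opD mulrDl (psiD F m cardF).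
    - by rewrite oppx WD.
    congr (if _ then _ else _); apply/idP/forall_inP => [yW w wW|h].
      by rewrite psi_eq1 iW.
    by apply: maxW => w /h; rewrite psi_eq1 => /eqP.
  rewrite exchange_big /=.
  transitivity (\sum_(w in W) if w \in rad a then #|F|%:R else 0 : rat).
    apply: eq_bigr => w _; rewrite (eq_bigl (fun y => y \in [set: F])) => [|y]; last by rewrite in_setT.
    rewrite sum_character => [|u v _ _|u v]; last first.
    - by rewrite mulrDr (psiD F m cardF).
    - by rewrite inE.
    rewrite cardsT radicalE // inE; congr (if _ then _ else _).
    apply/forall_inP/eqP => [h|-> y _]; last by rewrite mul0r psi_eq1 (tr0 F m).
    apply: (tr_nondeg F m m0 cardF) => y; apply/eqP; rewrite -(psi_eq1 F m).
    by apply: h; rewrite inE.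
  rewrite -big_mkcondr (eq_bigl (fun w => w \in rad a)) => [|w]; last first.
    by rewrite andb_idl // => /(subsetP kerW).
  by rewrite sumr_const mulr_natr.
rewrite -!natrM => /eqP; rewrite eqr_nat => /eqP.
rewrite card_radical // (card_subspace F m e M m0 cardF e_gt0 erefl W sW) cardF.
rewrite expnM -!expnD; set c := dim_over _ _ (rad a); set w := dim_over _ _ _.
move=> /(expnI _) E.
have /E wc : (1 < 2 ^ e)%N by rewrite -{1}(expn0 2) ltn_exp2l.
by have := congr1 odd wc; rewrite !oddD !addbb /= => <-.
Qed.

(** * Counting the forms by corank *)

Lemma card_forms : #|forms| = (2 ^ (n + m * k))%N.
Proof.
have -> : #|forms| = \sum_w \sum_(y : {ffun 'I_k -> F}) (w \in subF F n : nat).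
  rewrite -sum1_card big_mkcond /=.
  rewrite (sum_fcons F nat k (fun a => if a \in forms then 1%N else 0%N)).
  apply: eq_bigr => w _; apply: eq_bigr => y _.
  by rewrite inE fcons0; case: ifP.
under eq_bigr => w _ do rewrite sum_nat_const card_ffun card_ord cardF.
rewrite -big_distrr /= -big_mkcond sum1_card (card_subF F m m0 cardF n 2) //.
- transitivity (2 ^ (m * k) * 2 ^ n)%N; first by rewrite [(2 ^ (m * k))%N]expnM.
  by rewrite -expnD addnC.
- by rewrite muln_gt0 e_gt0 N_gt0.
- by rewrite -mulnA muln2 addnn.
Qed.

Definition nonzero_form (a : {ffun 'I_k.+1 -> F}) := [exists i : 'I_k.+1, (i < k)%N && (a i != 0)].

Lemma radical_dim_bound (a : {ffun 'I_k.+1 -> F}) :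
  a ord0 \in subF F n -> nonzero_form a -> (dim_over F K (rad a) <= (k.-1).*2)%N.
Proof.
move=> a0 /existsP[i /andP[ik ai]]; have := card_kernel_bound a i ik ai.
rewrite -radicalE // card_radical // leq_exp2l //.
by rewrite -{1}(expn0 2) ltn_exp2l.
Qed.

Lemma radical_dim_zero (a : {ffun 'I_k.+1 -> F}) : a ord0 \in subF F n ->
  ~~ nonzero_form a -> dim_over F K (rad a) = M.
Proof.
move=> a0; rewrite negb_exists => /forallP z.
have az (i : 'I_k.+1) : (i < k)%N -> a i = 0.
  by move=> ik; have := z i; rewrite ik /= negbK => /eqP.
have e2 : (1 < 2 ^ e)%N by rewrite -{1}(expn0 2) ltn_exp2l.
apply: (expnI e2); rewrite -card_radical // -expnM -cardF radicalE // -cardsT.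
congr #|pred_of_set _|; apply/setP => x; rewrite !inE /lin_op az // mul0r add0r.
rewrite big_nat_cond big1 ?eqxx // => j /andP[/andP[_ jk] _].
by rewrite az ?inordK ?mul0r ?frob0 ?addr0 // ltnW // ltnS.
Qed.

(** These tuples are parametrized by their last coordinate a_k in F. *)
Lemma card_zero_forms : #|[set a in forms | ~~ nonzero_form a]| = (2 ^ m)%N.
Proof.
pose g (c : F) : {ffun 'I_k.+1 -> F} := [ffun i => if i == ord_max then c else 0].
have g_inj : injective g.
  by move=> c c' /ffunP/(_ ord_max); rewrite !ffunE eqxx.
rewrite -cardF -cardsT -(card_imset _ g_inj); apply: eq_card => a; rewrite inE.
have ltk (i : 'I_k.+1) : (i < k)%N = (i != ord_max).
  by rewrite -val_eqE /= ltn_neqAle -ltnS ltn_ord andbT.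
apply/andP/imsetP => [[_ /existsPn z]|[c _ ->]].
  exists (a ord_max) => //; apply/ffunP => i; rewrite ffunE; case: eqP => [->//|/eqP im].
  by have := z i; rewrite ltk im /= negbK => /eqP.
split.
  rewrite inE ffunE (_ : (ord0 == ord_max) = false) ?subF0 //.
  by apply/negbTE; rewrite -val_eqE /= neq_ltn k_gt0.
by apply/existsPn => i; rewrite ltk ffunE; case: eqP; rewrite //= eqxx.
Qed.

Definition corank_count i :=
  #|[set a in forms | nonzero_form a & dim_over F K (rad a) == i.*2]|.

(** By parity and the bound 2k - 2, the corank of a nonzero form is 2i for exactly one i < k. *)
Lemma sum_corank_count (f : nat -> rat) :
  \sum_(i < k) (corank_count i)%:R * f i.*2 =
  \sum_(a in forms | nonzero_form a) f (dim_over F K (rad a)).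
Proof.
transitivity (\sum_(i < k) \sum_(a in forms | nonzero_form a)
    if dim_over F K (rad a) == i.*2 then f (dim_over F K (rad a)) else 0).
  apply: eq_bigr => i _; rewrite -big_mkcondr /= /corank_count -sum1_card natr_sum mulr_suml.
  apply: eq_big => [a|a]; first by rewrite inE andbA.
  by rewrite inE => /and3P[_ _ /eqP->]; rewrite mul1r.
rewrite exchange_big /=; apply: eq_bigr => a /andP[]; rewrite inE => a0 anz.
have := radical_dim_bound a a0 anz; have := radical_dim_even a a0.
move: (dim_over _ _ _) => c c_even ck.
have ck2 : (c./2 < k)%N.
  by rewrite -(prednK k_gt0) ltnS -(doubleK k.-1) half_leq.
have cE : c./2.*2 = c by rewrite -{2}(odd_double_half c) (negPf c_even).
rewrite (bigD1 (Ordinal ck2)) //= cE eqxx big1 ?addr0 // => i ic; case: eqP => // ci.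
by case/eqP: ic; apply/val_inj; rewrite /= ci doubleK.
Qed.

Local Notation Q := (4 ^ e)%N.

(** Since q^2 = Q, the even nodes of [eprod] become the nodes of a Gaussian binomial of base Q. *)
Lemma eprod_even v i : eprod (2 ^ e)%:R v i.*2
  = gbinom Q i v * \prod_(l < v) (Q%:Q ^+ l * (Q%:Q ^+ l.+1 - 1)).
Proof.
have Q1 : (1 < Q)%N by rewrite -{1}(expn0 4) ltn_exp2l.
rewrite -eprod_gbinom // /eprod; apply: eq_bigr => l _.
have E t : (2 ^ e)%:R ^+ t.*2 = Q%:Q ^+ t :> rat.
  have Q2 : Q = ((2 ^ e) ^ 2)%N by rewrite -expnM mulnC expnM.
  by rewrite -[Q%:Q]/(Q%:R) Q2 [((_ ^ _) ^ _)%:R]natrX -exprM mul2n.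
by rewrite !E.
Qed.

(** The moment over all forms comes from the walk, and the 2^m zero forms, of corank M, are
    subtracted. Both terms contain [eprod q v M], the source of the binomial with N = m/(2e). *)
Lemma corank_moments v : (v < k)%N ->
  \sum_(i < k) (corank_count i)%:R * gbinom Q i v
  = gbinom Q N v * ((2 ^ m)%:R * ((2 ^ (n * (2 * k - 1 - 2 * v) + e * v))%:R - 1)).
Proof.
move=> vk; set q : rat := (2 ^ e)%:R.
have q0 : q != 0 by rewrite pnatr_eq0 expn_eq0.
have Q1 : (1 < Q)%N by rewrite -{1}(expn0 4) ltn_exp2l.
set w := \prod_(l < v) (Q%:Q ^+ l * (Q%:Q ^+ l.+1 - 1)).
have w0 : w != 0.
  apply/prodf_neq0 => l _; rewrite mulf_neq0 ?QX_sub1_neq0 // expf_neq0 //.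
  by rewrite -[Q%:Q]/(Q%:R) pnatr_eq0 expn_eq0.
apply: (mulIf w0); rewrite mulr_suml.
transitivity (\sum_(i < k) (corank_count i)%:R * eprod q v i.*2).
  by apply: eq_bigr => i _; rewrite /q eprod_even mulrA.
rewrite sum_corank_count.
have := moments_transfer q q0 _ (mem forms) (fun a => dim_over F K (rad a)) M k #|forms|%:R
  sum_pprod_forms v vk.
rewrite (bigID nonzero_form) /=.
rewrite [X in _ + X](eq_bigr (fun=> eprod q v M)) => [|a /andP[]]; last first.
  by rewrite inE => a0 az; rewrite radical_dim_zero.
rewrite [X in _ + X](eq_bigl (fun a => a \in [set a in forms | ~~ nonzero_form a])) => [|a]; last first.
  by rewrite inE.
rewrite sumr_const card_zero_forms => /(canRL (addrK _)) ->.
rewrite (proj1 (walk_even_odd q q0 M v)).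
have -> : \prod_(i < v) (q * (1 - q ^+ i.*2 / q ^+ M))
    = q ^+ v / (q ^+ M) ^+ v * eprod q v M.
  rewrite -[(q ^+ M) ^- v]exprVn -exprMn /eprod -prodM_const; apply: eq_bigr => i _.
  by field; rewrite expf_neq0.
have -> : eprod q v M = gbinom Q N v * w by rewrite addnn -eprod_even.
rewrite card_forms.
have -> : (2 ^ (n + m * k))%:R
    = (2 ^ m)%:R * (2 ^ (n * (2 * k - 1 - 2 * v) + e * v))%:R * (q ^+ M) ^+ v / q ^+ v.
  apply: (mulIf (expf_neq0 v q0)); rewrite divfK ?expf_neq0 //.
  rewrite /q -!natrX -!natrM -!expnM -!expnD; congr (2 ^ _)%:R.
  (* As v < k, the truncated subtractions are exact. *)
  have -> : (2 * k - 1 - 2 * v = 2 * (k - v).-1 + 1)%N by lia.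
  rewrite -{1}(subnK (ltnW vk)) -{1}(prednK (n := k - v)%N) ?subn_gt0 //; nia.
rewrite -[X in _ - X]mulr_natr.
have: (q ^+ M) ^+ v != 0 by rewrite !expf_neq0.
have: q ^+ v != 0 by rewrite expf_neq0.
move: (q ^+ v) ((q ^+ M) ^+ v) (gbinom Q N v) ((2 ^ m)%:R)
  ((2 ^ (n * (2 * k - 1 - 2 * v) + e * v))%:R) => y z g t u y0 z0.
by field; rewrite y0 z0.
Qed.

(** Coranks of nonzero forms are at most 2k - 2 < M, so the truncated subtractions identify rank M -
    2j with corank 2j. *)
Lemma beta_corank j : (j < k)%N ->
  beta F n m d e k (M - 2 * j) = (corank_count j)%:R / (2 ^ m)%:R.
Proof.
move=> jk; congr (_%:R / _); apply: eq_card => a; rewrite [LHS]in_set [RHS]in_set.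
rewrite [a \in forms]in_set -/(nonzero_form a); case a0: (_ \in _) => //=.
rewrite andbC; case nz: (nonzero_form a) => //=.
have := radical_dim_bound a a0 nz; rewrite /rankB mulKn //.
move: (dim_over _ _ _) => c ck; apply/eqP/eqP; lia.
Qed.

Lemma beta_formula j : (j < k)%N ->
  beta F n m d e k (M - 2 * j) =
  \sum_(j <= v < k)
     (-1) ^+ (v - j) * ((4 ^ (e * 'C(v - j, 2)))%:R : rat)
     * gbinom Q v j * gbinom Q N v
     * (((2 ^ (n * (2 * k - 1 - 2 * v) + e * v))%:R : rat) - 1).
Proof.
move=> jk; rewrite beta_corank //.
have Q1 : (1 < Q)%N by rewrite -{1}(expn0 4) ltn_exp2l.
rewrite (gbinom_inversion Q Q1 k (fun i => (corank_count i)%:R) _ corank_moments j jk).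
rewrite mulr_suml; apply: eq_bigr => v _.
rewrite -[Q%:Q]/(Q%:R) [(4 ^ (e * _))%N]expnM [(_ ^ 'C(_, _))%:R]natrX; field.
by rewrite pnatr_eq0 expn_eq0.
Qed.

End Forms.

Theorem theorem8p2 (F : finFieldType) (m n d e k : nat) :
  (0 < m)%N -> (0 < n)%N -> (0 < d)%N -> (0 < e)%N -> (0 < k)%N ->
  m = (2 * n)%N -> e = gcdn n d -> e = gcdn m d ->
  (1 <= k <= n %/ e)%N ->
  #|F| = (2 ^ m)%N ->
  forall j : nat, (j < k)%N ->
  beta F n m d e k (m %/ e - 2 * j) =
  \sum_(j <= v < k)
     (-1) ^+ (v - j) * ((4 ^ (e * 'C(v - j, 2)))%:R : rat)
     * gbinom (4 ^ e) v j * gbinom (4 ^ e) (m %/ (2 * e)) v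
     * (((2 ^ (n * (2 * k - 1 - 2 * v) + e * v))%:R : rat) - 1).
Proof.
move=> _ _ _ e0 k0 mE en em /andP[_ kN] cardF j jk.
have /dvdnP[N nE] : (e %| n)%N by rewrite en dvdn_gcdl.
have /dvdnP[D dE] : (e %| d)%N by rewrite en dvdn_gcdr.
move: mE en em kN cardF; rewrite {}nE {}dE mulnK // => -> en em kN cardF.
rewrite (_ : 2 * (N * e) = e * (N + N))%N in em cardF *; last by lia.
(* Dividing e = gcd(m, d) by e gives this; since N + N is even, D is then odd. *)
have DN : coprime D (N + N).
  by rewrite /coprime gcdnC -(eqn_pmul2l e0) muln1 muln_gcdr (mulnC e D) -em.
have Dodd : odd D.
  move: DN; apply: contraLR => /negbTE Deven; rewrite coprime_sym addnn -muln2 coprimeMl.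
  by rewrite negb_and; apply/orP; right; rewrite coprime2n Deven.
rewrite mulKn // [(2 * e)%N]mulnC divnMA mulKn // addnn -muln2 mulnK //.
rewrite (mulnC N) (mulnC D) muln2 -addnn in cardF *.
exact: beta_formula.
Qed.
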